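(* $\mathrm{SCM}(6,3;3;*,2,4)=\mathrm{RE}$. That is, a language is recursively enumerable if and only if it is generated by an SCM grammar with all of the following properties: - degree $(6,3)$; - at most $3$ nonterminals; - an arbitrary finite number of conditional matrices; - all matrices of length at most $2$; - at most $4$ non-simple matrices.
   Context: A semi-conditional matrix (SCM) grammar is a quadruple $G=(V,T,M,S)$ with the following components. - $V$ is a finite alphabet and $T\subsetneq V$ is the set of terminals. - $N=V\setminus T$ is the set of nonterminals and $S\in N$ is the start symbol. - $M$ is a finite set of matrices of the form $r=[(A_1\to x_1),\dots,(A_\ell\to x_\ell),P,F]$, where $\ell\ge 1$, $A_k\in N$, $x_k\in V^*$, and $P,F\in V^+\cup\{\emptyset\}$. Here $\emptyset\notin V$ is a special symbol meaning that the condition is absent, and $|\emptyset|=0$. The number $\ell$ is the length of $r$. A matrix is classified as follows: - unconditional if $P=F=\emptyset$, and conditional otherwise; - simple if at least one of $P,F$ equals $\emptyset$, and non-simple if both $P\neq\emptyset$ and $F\neq\emptyset$. For $x,y\in V^*$ we write $x\Rightarrow_r y$ iff all of the following hold: 1. if $P\neq\emptyset$ then $P$ is a subword (factor) of $x$; 2. if $F\neq\emptyset$ then $F$ is not a subword of $x$; 3. there are words $x=y_0,y_1,\dots,y_\ell=y$ such that $y_k$ is obtained from $y_{k-1}$ by replacing one occurrence of $A_k$ by $x_k$. $\Rightarrow_G$ is the union of the relations $\Rightarrow_r$ over $r\in M$, and $L(G)=\{y\in T^*: S\Rightarrow_G^* y\}$. $G$ has degree $(i,j)$ if every matrix satisfies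 $|P|\le i$ and $|F|\le j$. $\mathrm{SCM}(i,j;n;m,\ell,s)$ denotes the family of languages $L(G)$ of SCM grammars $G$ that satisfy all of the following: - $G$ has degree $(i,j)$; - $|N|\le n$; - $G$ has at most $m$ conditional matrices; - every matrix of $G$ has length at most $\ell$; - $G$ has at most $s$ non-simple matrices. A $*$ in a parameter position means that parameter is unbounded. $\mathrm{SSCM}(i,j;n;m,\ell)=\mathrm{SCM}(i,j;n;m,\ell,0)$, i.e., all matrices are simple. $\mathrm{RE}$ is the class of recursively enumerable languages. *)

(* Defs.v *)
From mathcomp Require Import all_boot.
From Stdlib Require List.
Set Implicit Arguments. Unset Strict Implicit. Unset Printing Implicit Defensive.

(* Symbols of the total alphabet V = T + N : terminals are [inl a],
   nonterminals are [inr A]. Words are sequences of symbols. *)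
Definition sym (T N : Type) := (T + N)%type.
Definition word (T N : Type) := seq (sym T N).

(* A matrix [(A_1 -> x_1),...,(A_l -> x_l), P, F]; [None] encodes the
   absent condition (the symbol "emptyset" of the paper). *)
Record scm_matrix (T N : Type) := SCMMatrix {
  mx_rules : seq (N * word T N);
  mx_perm  : option (word T N);
  mx_forb  : option (word T N) }.

Definition cond_size (T N : Type) (c : option (word T N)) : nat :=
  if c is Some w then size w else 0.

Definition wf_matrix (T N : Type) (r : scm_matrix T N) : Prop :=
  0 < size (mx_rules r) /\
  (forall w, mx_perm r = Some w -> 0 < size w) /\
  (forall w, mx_forb r = Some w -> 0 < size w).

Definition present (X : Type) (c : option X) : bool :=
  if c is Some _ then true else false.

Definition unconditional (T N : Type) (r : scm_matrix T N) : bool :=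
  ~~ present (mx_perm r) && ~~ present (mx_forb r).
Definition conditional (T N : Type) (r : scm_matrix T N) : bool :=
  ~~ unconditional r.
Definition nonsimple (T N : Type) (r : scm_matrix T N) : bool :=
  present (mx_perm r) && present (mx_forb r).

Definition rewrite1 (T N : Type) (A : N) (x : word T N) (u v : word T N) : Prop :=
  exists w1 w2, u = w1 ++ inr A :: w2 /\ v = w1 ++ x ++ w2.

Fixpoint apply_rules (T N : Type) (rs : seq (N * word T N)) (u v : word T N) : Prop :=
  match rs with
  | [::] => u = v
  | (A, x) :: rs' => exists u', rewrite1 A x u u' /\ apply_rules rs' u' v
  end.

Definition scm_step (T N : finType) (r : scm_matrix T N) (x y : word T N) : Prop :=
  (forall P, mx_perm r = Some P -> infix P x) /\
  (forall F, mx_forb r = Some F -> ~~ infix F x) /\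
  apply_rules (mx_rules r) x y.

Inductive rtc (X : Type) (R : X -> X -> Prop) : X -> X -> Prop :=
  | rtc_refl x : rtc R x x
  | rtc_step x y z : R x y -> rtc R y z -> rtc R x z.

Definition scm_derives (T N : finType) (M : seq (scm_matrix T N)) :=
  rtc (fun x y => exists2 r, List.In r M & scm_step r x y).

Definition scm_generates (T N : finType) (M : seq (scm_matrix T N)) (S : N)
  (w : seq T) : Prop :=
  scm_derives M [:: inr S] (map inl w).

Definition SCM (i j n : nat) (m : option nat) (l s : nat)
  (T : finType) (L : seq T -> Prop) : Prop :=
  exists (N : finType) (S : N) (M : seq (scm_matrix T N)),
    [/\ #|N| <= n /\ (forall r, List.In r M -> wf_matrix r),
        (forall r, List.In r M -> cond_size (mx_perm r) <= i /\ cond_size (mx_forb r) <= j),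
        (if m is Some m' then count (@conditional T N) M <= m' else True),
        (forall r, List.In r M -> size (mx_rules r) <= l) /\
        count (@nonsimple T N) M <= s &
        (forall w, L w <-> scm_generates M S w)].

(* Recursively enumerable languages: languages generated by          *)
(* phrase-structure (type-0, unrestricted) grammars.                 *)

Definition ps_step (T N : finType) (R : seq (word T N * word T N)) (x y : word T N) : Prop :=
  exists u v w1 w2, List.In (u, v) R /\ x = w1 ++ u ++ w2 /\ y = w1 ++ v ++ w2.

Definition RE (T : finType) (L : seq T -> Prop) : Prop :=
  exists (N : finType) (S : N) (R : seq (word T N * word T N)),
    (forall u v, List.In (u, v) R -> has (fun a : sym T N => if a is inr _ then true else false) u) /\
    (forall w, L w <-> rtc (ps_step R) [:: inr S] (map inl w)).

(* Main.v *)
Require Import Defs.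
From mathcomp Require Import all_boot zify.
From Stdlib Require Import ClassicalEpsilon.
Set Implicit Arguments. Unset Strict Implicit. Unset Printing Implicit Defensive.

(* A type-0 derivation, read backwards from the terminal word, is a Post
   correspondence: both halves spell a sequence of sentential forms (reversed and
   separated by [None]), one half being one form ahead of the other.  An SCM
   grammar with nonterminals D = [None], A = [Some true] and B = [Some false] first
   writes the two halves, coded in A and B, on the two sides of a pair of adjacent
   pebbles D D, and then cancels them symbol by symbol at the pebbles.  A matrix
   erases one pebble and replaces some letter by the other one; since every later
   permitting context contains D D, the derivation survives only if the replaced
   letter was next to the pebbles, so these context-free matrices act as local
   rewriting rules.

   Conversely, a type-0 grammar simulates a matrix by a head that moves over the
   word, tests the two conditions and applies the context-free rules in turn. *)

(** * Words, closures and lists *)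

Lemma cat_cons_eq (X : Type) (a b c d : seq X) (x y : X) :
  a ++ x :: b = c ++ y :: d ->
  [\/ [/\ a = c, x = y & b = d],
      exists2 m, c = a ++ x :: m & b = m ++ y :: d |
      exists2 m, a = c ++ y :: m & d = m ++ x :: b].
Proof.
elim: a c => [|e a IH] [|f c] /=.
- by case=> -> ->; apply: Or31.
- by case=> -> ->; apply: Or32; exists c.
- by case=> -> <-; apply: Or33; exists a.
- case=> -> /IH [[-> -> ->]|[m -> ->]|[m -> ->]].
  + exact: Or31.
  + by apply: Or32; exists m.
  + by apply: Or33; exists m.
Qed.

(** With [p] recognising heads, this makes the unique head of a sentential form determine where a
    rule is applied to it. *)
Lemma cat_mem_eq (X : eqType) (a b c d : seq X) (h h' : X) (p : pred X) :
  ~~ has p a -> ~~ has p b -> p h -> p h' ->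
  a ++ h :: b = c ++ h' :: d -> [/\ a = c, h = h' & b = d].
Proof.
move=> ha hb ph ph' e0; case: (cat_cons_eq e0) => [//|[m _ e]|[m e _]].
- by move: hb; rewrite e has_cat /= ph' orbT.
- by move: ha; rewrite e has_cat /= ph' orbT.
Qed.

Section Closure.
Variables (X : Type) (E : X -> X -> Prop).

Lemma rtc_trans x y z : rtc E x y -> rtc E y z -> rtc E x z.
Proof. by elim=> // a b c ab _ IH /IH; apply: rtc_step. Qed.

Lemma rtc_one x y : E x y -> rtc E x y.
Proof. by move=> xy; apply: rtc_step xy _; apply: rtc_refl. Qed.

Lemma rtc_invariant (I : X -> Prop) :
  (forall x y, I x -> E x y -> I y) -> forall x y, rtc E x y -> I x -> I y.
Proof. by move=> IE x y; elim=> // a b c ab _ IH /IE /(_ ab) /IH. Qed.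

End Closure.

Lemma In_mem (X : eqType) (x : X) s : List.In x s <-> x \in s.
Proof.
elim: s => [|y s IH] //=; rewrite inE; split.
- by case=> [->|/IH ->]; rewrite ?eqxx ?orbT.
- by case/orP=> [/eqP ->|/IH]; [left|right].
Qed.

Lemma In_cat (X : Type) (x : X) s t : List.In x (s ++ t) <-> List.In x s \/ List.In x t.
Proof. exact: List.in_app_iff. Qed.

Lemma In_map (X Y : Type) (f : X -> Y) s y :
  List.In y (map f s) <-> exists2 x, List.In x s & y = f x.
Proof.
elim: s => [|x s IH] /=; first by split=> // -[].
split.
- by case=> [<-|/IH [z zs ->]]; [exists x; [left|]|exists z; [right|]].
- by case=> z [->|zs] e; [left|right; apply/IH; exists z].
Qed.

(** * Derivations as a Post correspondence *)

Section Correspondence.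
Variables (T N : finType) (S : N) (R : seq (word T N * word T N)).

Definition letter := option (sym T N).
Definition piece := ((word T N * word T N) * letter)%type.

Definition mirror (x : word T N) : seq letter := map Some (rev x).
Definition top1 (p : piece) : seq letter := rcons (mirror p.1.1) p.2.
Definition bot1 (p : piece) : seq letter := rcons (mirror p.1.2) p.2.

(* The pair ([::], [::]) provides the pieces that copy one letter; letting
   every piece end in an explicit letter keeps both of its halves nonempty. *)
Definition pieces : seq piece :=
  [seq (r, c) | r <- ([::], [::]) :: R, c <- enum {: option (T + N)}].

Definition tops (ps : seq piece) := flatten (map top1 ps).
Definition bots (ps : seq piece) := flatten (map bot1 ps).

Definition goal : seq letter := [:: Some (inr S); None].

(** [q] is the lead of the upper half over the lower one. It acts as a queue: a piece takes [bot1]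
    from its front and adds [top1] at its rear, which undoes one rule application. *)
Definition solves (q : seq letter) (ps : seq piece) :=
  {subset ps <= pieces} /\ q ++ tops ps = bots ps ++ goal.

Lemma mem_pieces r c : (r, c) \in pieces = (r == ([::], [::])) || (r \in R).
Proof.
apply/allpairsP/idP => [[[r' c'] /= [r'R _ [-> _]]]|rR]; first by rewrite inE in r'R.
by exists (r, c); rewrite /= mem_enum inE.
Qed.

Lemma solves_copy c q ps : solves (rcons q c) ps -> solves (c :: q) ((([::], [::]), c) :: ps).
Proof.
case=> sub e; split=> [p|]; first by rewrite inE => /predU1P [->|/sub //]; rewrite mem_pieces.
by rewrite /tops /bots /= -cat1s -cat_rcons e.
Qed.

Lemma solves_copies s q ps : solves (q ++ s) ps -> exists ps', solves (s ++ q) ps'.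
Proof.
elim: s q ps => [|c s IH] q ps; first by rewrite cats0; exists ps.
rewrite -cat_rcons => /IH [ps' h]; exists ((([::], [::]), c) :: ps').
by apply: solves_copy; rewrite rcons_cat.
Qed.

Lemma solves_rule l r c q ps : (l, r) \in R ->
  solves (q ++ rcons (mirror l) c) ps -> solves (rcons (mirror r) c ++ q) (((l, r), c) :: ps).
Proof.
move=> lr [sub e]; split=> [p|].
  by rewrite inE => /predU1P [->|/sub //]; rewrite mem_pieces lr orbT.
by rewrite /tops /bots /= -/(tops _) -/(bots _) {1}/top1 {1}/bot1 /= -!catA; congr cat;
  rewrite -e -catA.
Qed.

Lemma mirror_cat x y : mirror (x ++ y) = mirror y ++ mirror x.
Proof. by rewrite /mirror rev_cat map_cat. Qed.

Lemma derives_solvable x : rtc (ps_step R) [:: inr S] x ->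
  exists ps, solves (rcons (mirror x) None) ps.
Proof.
move=> d; pose I x := exists ps, solves (rcons (mirror x) None) ps.
apply: (rtc_invariant (I := I) _ d); last by exists [::].
move=> g f [ps sg] [u [v [w1 [w2 [/In_mem uv [eg ef]]]]]].
(* The piece also needs the letter [c] after [mirror u]: the last letter of [w1], or the separator
   if [w1] is empty. *)
case e1: (rcons (mirror w1) None) => [|c q]; first by move/(congr1 size): e1; rewrite size_rcons.
(* The new queue is rotated past [mirror w2], the piece trades [v] for [u], and rotating past [q]
   restores the queue of the old form. *)
suff [ps' h]: exists ps', solves (rcons (mirror v) c ++ q ++ mirror w2) ps'.
  rewrite /I ef !mirror_cat -!catA !rcons_cat e1; apply: (@solves_copies _ _ ps').
  by move: h; rewrite cat_rcons -catA.
have [|ps' h] := @solves_copies q (mirror w2 ++ rcons (mirror u) c) ps.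
  by move: sg; rewrite eg !mirror_cat -!catA !rcons_cat e1 cat_rcons.
exists (((u, v), c) :: ps'); apply: solves_rule => //.
by rewrite -catA.
Qed.

Lemma mirror_inj : injective mirror.
Proof. by move=> x y /(inj_map (@Some_inj _)) /(can_inj revK). Qed.

(** Mirrored words contain no [None], so a lower half ends either strictly inside [y] or on the
    separator. *)
Lemma mirror_prefix y q v c q' : mirror y ++ None :: q = mirror v ++ c :: q' ->
  (exists s y2, [/\ y = rcons y2 s ++ v, c = Some s & q' = mirror y2 ++ None :: q]) \/
  [/\ y = v, c = None & q' = q].
Proof.
have nN x a b : mirror x <> a ++ None :: b.
  by move/(congr1 (has (pred1 None))); rewrite has_cat /= orbT has_map; elim: (rev x).
move=> e; case: (cat_cons_eq e) => [[/mirror_inj -> <- ->]|[m /nN //]|[m ey ->]].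
  by right.
left; have ey' : y = rev (pmap id m) ++ rev (pmap id [:: c]) ++ v.
  move/(congr1 (fun s => rev (pmap id s))): ey; rewrite -(cat1s c) !pmap_cat !rev_cat.
  have K x : rev (pmap id (mirror x)) = x.
    by rewrite /mirror -[RHS]revK; congr rev; elim: (rev x) => //= a s ->.
  by rewrite !K catA.
case: c e ey ey' => [s|] e ey ey'; last by case: (nN _ _ _ ey).
exists s, (rev (pmap id m)); split=> //; first by rewrite ey' /= -cats1 -catA.
move: ey; rewrite ey' !mirror_cat -catA /= => /eqP; rewrite eqseq_cat // => /andP [_].
by rewrite /mirror /= => /eqP [->].
Qed.

(** The queue holds the form [y ++ x], processed from its right end: [x] is the part already copied
    or rewritten. Consuming the separator begins the next pass. *)
Lemma solvable_derives ps y x :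
  solves (mirror y ++ None :: mirror x) ps -> rtc (ps_step R) [:: inr S] (y ++ x).
Proof.
elim: ps y x => [|[[u v] c] ps IH] y x [sub e].
  move: e; rewrite cats0 /bots /goal /= -[[:: Some _; _]]/(mirror [:: inr S] ++ [:: None]).
  case/mirror_prefix => [[s [y2 [_ //]]]|[-> _ e]].
  by case: x e => [_|a x /(congr1 size)]; [apply: rtc_refl|rewrite /mirror size_map size_rev].
have := sub _ (mem_head _ _); rewrite mem_pieces => uv.
move: e; rewrite /tops /bots /= -/(tops _) -/(bots _) {1}/top1 {1}/bot1 /= => e.
have step a b : rtc (ps_step R) [:: inr S] (a ++ u ++ b) ->
                rtc (ps_step R) [:: inr S] (a ++ v ++ b).
  case/orP: uv => [/eqP [-> ->] //|uv] d; apply: (rtc_trans d); apply: rtc_one.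
  by exists u, v, a, b; split; first exact/In_mem.
have sub' : {subset ps <= pieces} by move=> p pp; apply: sub; rewrite inE pp orbT.
move: e; rewrite -!catA !cat_rcons /= => /mirror_prefix.
case=> [[s [y2 [-> -> e]]]|[-> -> e]].
  rewrite -catA; apply: step; rewrite cat_rcons.
  apply: (IH y2 (s :: u ++ x)); split=> //.
  by rewrite e -(cat1s s) !mirror_cat -!catA /= -!catA.
apply: (step [::]); rewrite /= -[u ++ x]cats0; apply: (IH _ [::]).
by split=> //; rewrite mirror_cat e -!catA.
Qed.

(** With the separator in front, prepending a letter to [w] appends one to [start w], just as a
    piece extends the upper half. *)
Definition start (w : seq T) : seq letter := None :: mirror (map inl w).

Definition accepted (w : seq T) : Prop := exists ps, solves (start w) ps.

Lemma acceptedP w : accepted w <-> rtc (ps_step R) [:: inr S] (map inl w).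
Proof.
split=> [[ps]|/derives_solvable [ps sol]]; first exact: (@solvable_derives ps [::]).
by exists ((([::], [::]), None) :: ps); apply: solves_copy.
Qed.

(** A unary prefix code. Its first bit is always [true], which [gen_matrix] exploits; its last bit
    is always [false], which keeps the pop matrices inapplicable while the halves are being
    written. *)
Definition code (c : letter) : seq bool :=
  rcons (nseq (enum_rank (c : option (T + N))).+1 true) false.
Definition bits (s : seq letter) := flatten (map code s).

Lemma bits_cat s t : bits (s ++ t) = bits s ++ bits t.
Proof. by rewrite /bits map_cat flatten_cat. Qed.

Lemma bits_inj : injective bits.
Proof.
have code_inj c d s t : code c ++ s = code d ++ t -> c = d /\ s = t.
  rewrite /code !cat_rcons => e.
  have [eN ->] : enum_rank (c : option (T + N)) = enum_rank (d : option (T + N)) :> nat /\ s = t.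
    move: e => /=; move: (nat_of_ord _) (nat_of_ord _) => i j [].
    by elim: i j => [|i IH] [|j] //= []; do [move=> -> | move/IH=> [-> ->]].
  by split=> //; apply: (@enum_rank_inj (option (T + N))); apply: val_inj.
elim=> [|c s IH] [|d t] //.
by rewrite /bits /= => /code_inj [-> /IH ->].
Qed.

Lemma bits_head c s : bits (c :: s) = true :: behead (bits (c :: s)).
Proof. by []. Qed.

Lemma rev_bits_head s c : exists t, rev (bits (rcons s c)) = false :: t.
Proof.
rewrite -cats1 bits_cat rev_cat {1}/bits /= cats0 /code -rcons_cons rev_rcons.
by eexists.
Qed.

End Correspondence.

(** * Pebble configurations *)

Section Pebbles.
Variable T : finType.

Notation letters := (word T (option bool)).
Notation cD := (@inr T (option bool) None).
Notation cA := (@inr T (option bool) (Some true)).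
Notation cB := (@inr T (option bool) (Some false)).

(* Two adjacent pebbles separate a left stack, listed from its top, from a
   right stack. *)
Definition config (l r : letters) : letters := rev l ++ cD :: cD :: r.

Definition pebble_free (x : letters) := cD \notin x.

(* A configuration whose pebbles were driven apart; the surviving [cB] blocks
   the initial matrices. *)
Definition dead (x : letters) : Prop :=
  cB \in x /\ exists a m b, [/\ x = a ++ cD :: m ++ cD :: b, m <> [::],
    pebble_free a, pebble_free m & pebble_free b].

Definition context (p q : letters) : letters := rev p ++ cD :: cD :: q.

Lemma pebble_free_split (x a b : letters) : pebble_free x -> x <> a ++ cD :: b.
Proof. by move=> fx e; move: fx; rewrite /pebble_free e mem_cat inE eqxx orbT. Qed.

Lemma pebble_freeE (x : letters) : pebble_free x = (count_mem cD x == 0).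
Proof. by rewrite /pebble_free -has_pred1 has_count -leqNgt leqn0. Qed.

Lemma config_split l r p s : pebble_free l -> pebble_free r ->
  config l r = p ++ cD :: s ->
  (p = rev l /\ s = cD :: r) \/ (p = rcons (rev l) cD /\ s = r).
Proof.
move=> fl fr e0; case: (cat_cons_eq e0) => [[-> _ <-]|[[|a m] -> []]|[m e _]]; first by left.
- by move=> <-; right; rewrite cats1.
- by move=> _ /(pebble_free_split fr).
- by have := @pebble_free_split (rev l) p m; rewrite /pebble_free mem_rev => /(_ fl).
Qed.

Lemma infix_context p q l r : pebble_free l -> pebble_free r ->
  reflect ((exists s, l = p ++ s) /\ (exists s, r = q ++ s))
          (infix (context p q) (config l r)).
Proof.
move=> fl fr; apply: (iffP idP) => [/infixP [a [b]]|[[s ->] [t ->]]].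
  rewrite /context -!catA /= catA => /(config_split fl fr) [[e [e']]|[e e']].
    split; last by exists b.
    by exists (rev a); rewrite -[l]revK -e rev_cat revK.
  by case: (pebble_free_split (a := [::]) fr (esym e')).
by apply/infixP; exists (rev s), t; rewrite /context /config rev_cat -!catA.
Qed.

Lemma dead_no_context x p q : dead x -> ~~ infix (context p q) x.
Proof.
case=> _ [a [m [b [-> m0 fa fm fb]]]]; apply/infixP => -[c [d]].
rewrite /context -!catA /= catA => e0; case: (cat_cons_eq e0) => {e0} [[_ _]|[n _ e]|[n e _]]; last first.
- exact: (pebble_free_split fa e).
- case: (cat_cons_eq e) => {e} [[_ _ e]|[k _ e]|[k e _]].
  + exact: (pebble_free_split (a := [::]) fb e).
  + exact: (pebble_free_split fb e).
  + exact: (pebble_free_split fm e).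
case: m m0 fm => // s m _ fm [es _].
by move: fm; rewrite es /pebble_free inE eqxx.
Qed.

(* The replacement of [x] releases a pebble while the other pebble is erased
   or traded for [v]: the pebbles remain adjacent only if [x] was next to them. *)
Definition pebble_matrix (v : letters) (x : bool) (y p q : letters) :=
  SCMMatrix [:: (None, v); (Some x, rcons (rev y) cD)] (Some (context p q)) None.

Lemma rewrite1_count A x (u v : letters) :
  rewrite1 A x u v -> count_mem cB u <= (A == Some false) + count_mem cB v.
Proof. by case=> a [b [-> ->]]; rewrite !count_cat /=; case: A => [[]|] /=; lia. Qed.

Lemma deadI u a m b : u = a ++ cD :: m ++ cD :: b -> cB \in u -> m <> [::] ->
  pebble_free (a ++ m ++ b) -> dead u.
Proof.
move=> -> hB m0; rewrite /pebble_free !mem_cat !negb_or => /and3P [fa fm fb].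
by split=> //; exists a, m, b.
Qed.

(** Once a pebble is traded for [v], the letter [x] may be taken anywhere. Just left of the
    remaining pebble it gives the second or third outcome; on the right the released pebble comes
    after [rev y], so adjacency forces [y = [::]]; elsewhere the word is dead. Two letters [cB] are
    required because the replaced letter may be one of them and a dead word must keep one. *)
Lemma pebble_step v x y p q l r u :
  pebble_free v -> pebble_free y -> pebble_free l -> pebble_free r ->
  1 < count_mem cB (config l r) -> scm_step (pebble_matrix v x y p q) (config l r) u ->
  [/\ exists s, l = p ++ s, exists s, r = q ++ s &
   [\/ dead u,
       exists2 z, l = inr (Some x) :: z & u = config (y ++ z) (v ++ r),
       exists2 z, rev v ++ l = inr (Some x) :: z & u = config (y ++ z) r |
       y = [::] /\ ((exists2 z, r = inr (Some x) :: z & u = config (rev v ++ l) z) \/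
                   (exists2 z, v ++ r = inr (Some x) :: z & u = config l z))]].
Proof.
move=> fv fy fl fr cB2 [/(_ _ erefl) /(infix_context _ _ fl fr) [hp hq] [_ /= ]].
case=> u1 [st1 [u2 [st2 <-]]]; split=> // {u hp hq p q}.
have hB : cB \in u2.
  have := leq_trans (leq_trans cB2 (rewrite1_count st1)) (rewrite1_count st2).
  rewrite -has_pred1 has_count; case: (Some x == _) => [|/ltnW //].
  by rewrite add1n ltnS.
case: st1 st2 => a [b [/(config_split fl fr) e1 ->]] [c [d [e2 e3]]].
have nX : cD <> inr (Some x) by [].
have F : pebble_free (v ++ y ++ l ++ r).
  by rewrite /pebble_free !mem_cat !negb_or; apply/and4P.
have free e f g : count_mem cD (e ++ f ++ g) <= count_mem cD (v ++ y ++ l ++ r) ->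
    pebble_free (e ++ f ++ g).
  by move: F; rewrite !pebble_freeE => /eqP ->; rewrite leqn0.
(* Either the left pebble is erased, or the right one. *)
case: e1 e2 => [[-> ->]|[-> ->]] e2.
- rewrite catA in e2; case: (cat_cons_eq e2) => [[_ /nX //]|[m ec er]|[m ec es]].
  + case e: (m ++ rev y) => [|s n].
      case: m e ec er => //= ey ec er; apply: Or44.
      have ey' : y = [::] by rewrite -[y]revK ey.
      split=> //; left; exists d => //.
      by rewrite e3 ec ey' /config rev_cat revK -!catA.
    apply: Or41; apply: (@deadI _ (rev l ++ v) (m ++ rev y) d) => //.
    * by rewrite e3 ec -cats1 -!catA.
    * by rewrite e.
    * by apply: free; rewrite er !count_cat !count_rev /=; lia.
  + case: m ec es => [|s m] ec es.
      apply: Or43; exists (rev c).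
        by rewrite -[l]revK -rev_cat ec rev_cat.
      by rewrite e3 es /config rev_cat revK -cats1 -!catA.
    apply: Or41; apply: (@deadI _ (c ++ rev y) (s :: m) r) => //.
      by rewrite e3 es -cats1 -!catA.
    apply: free; move/(congr1 (count_mem cD)): ec.
    by rewrite !count_cat !count_rev /=; lia.
- rewrite cat_rcons in e2; case: (cat_cons_eq e2) => [[_ /nX //]|[m ec er]|[m ec es]].
  + case e: (m ++ rev y) => [|s n].
      case: m e ec er => //= ey ec er; apply: Or44.
      have ey' : y = [::] by rewrite -[y]revK ey.
      split=> //; right; exists d => //.
      by rewrite e3 ec ey' /config -cats1 -!catA.
    apply: Or41; apply: (@deadI _ (rev l) (m ++ rev y) d) => //.
    * by rewrite e3 ec -cats1 -!catA.
    * by rewrite e.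
    * apply: free; move/(congr1 (count_mem cD)): er.
      by rewrite !count_cat !count_rev /=; lia.
  + case: m ec es => [|s m] ec es.
      apply: Or42; exists (rev c).
        by rewrite -[l]revK ec rev_cat.
      by rewrite e3 es /config rev_cat revK -cats1 -!catA.
    apply: Or41; apply: (@deadI _ (c ++ rev y) (s :: m) (v ++ r)) => //.
      by rewrite e3 es -cats1 -!catA.
    apply: free; move/(congr1 (count_mem cD)): ec.
    by rewrite !count_cat !count_rev /=; lia.
Qed.

(** The right pebble turns into [v], and the top of the left stack releases a new pebble beside the
    left one. *)
Lemma pebble_left v x y p q l r s t :
  pebble_free (inr (Some x) :: l) -> pebble_free r ->
  inr (Some x) :: l = p ++ s -> r = q ++ t ->
  scm_step (pebble_matrix v x y p q) (config (inr (Some x) :: l) r) (config (y ++ l) (v ++ r)).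
Proof.
move=> fl fr el er; split=> [_ [<-]|].
  by apply/infix_context => //; split; [exists s|exists t].
split=> //=; exists (rev l ++ inr (Some x) :: cD :: v ++ r); split.
  exists (rev (cD :: inr (Some x) :: l)), r.
  by rewrite /config !rev_cons -!cats1 -!catA.
exists (config (y ++ l) (v ++ r)); split=> //; exists (rev l), (cD :: v ++ r); split=> //.
by rewrite /config rev_cat -cats1 -!catA.
Qed.

Lemma pop_right x p q l r s t :
  pebble_free l -> pebble_free (inr (Some x) :: r) ->
  l = p ++ s -> inr (Some x) :: r = q ++ t ->
  scm_step (pebble_matrix [::] x [::] p q) (config l (inr (Some x) :: r)) (config l r).
Proof.
move=> fl fr el er; split=> [_ [<-]|].
  by apply/infix_context => //; split; [exists s|exists t].
split=> //=; exists (rev l ++ cD :: inr (Some x) :: r); split.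
  by exists (rev l), (cD :: inr (Some x) :: r).
exists (config l r); split=> //; exists (rcons (rev l) cD), r.
by rewrite /config -!cats1 -!catA.
Qed.

(** * The grammar *)

Variables (N : finType) (S : N) (R : seq (word T N * word T N)).

(* A bit is written with one or two letters [cA]; the numbers of letters on the
   left and on the right of the pebbles add up to three for equal bits. *)
Definition runl (b : bool) : letters := if b then [:: cA; cA] else [:: cA].
Definition runr (b : bool) : letters := if b then [:: cA] else [:: cA; cA].

(** The separators differ in length so that three letters [cB] facing a [cA] can only mean an
    exhausted left run: when separators are being removed, at most two are left on the left once the
    right one is gone. *)
Fixpoint blocksl (x : seq bool) : letters :=
  if x is b :: x' then runl b ++ cB :: cB :: cB :: blocksl x' else [::].
Fixpoint blocksr (x : seq bool) : letters :=
  if x is b :: x' then runr b ++ cB :: cB :: blocksr x' else [::].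

Notation code := (@code T N).
Notation bits := (@bits T N).
Notation start := (@start T N).
Notation goal := (@goal T N S).

(** No block contains three consecutive letters [cA]; they signal that the halves are still being
    written. *)
Definition marker (x : seq bool) : letters :=
  [:: cA; cA; cA; cB; cB; cB] ++ blocksl x.

(** Every later word with a pebble contains [cB], so this matrix can only be used at the start. *)
Definition init_matrix (w : seq T) :=
  SCMMatrix [:: (@None bool, config (marker (rev (bits (start w)))) (map inl w))]
            None (Some [:: cB]).

(** The old marker without its top letter is already the block of the bit [true], the first bit of
    [bits s]; this explains [behead]. *)
Definition gen_matrix (s : seq (letter T N)) (v q : letters) :=
  pebble_matrix v true (marker (rev (behead (bits s)))) [:: cA; cA; cA] q.

(** A visible terminal [b] shows that no piece has been written yet, since its lower half would
    cover [b]. The first letter of the word therefore has to come from [init_matrix]. *)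
Definition terminal_matrix (a b : T) :=
  gen_matrix [:: Some (inl a)] [:: inl a] [:: inl b].

Definition piece_matrix (p : piece T N) :=
  gen_matrix (top1 p) (blocksr (rev (bits (bot1 p)))) [::].

(* Replacing its top letter turns the marker into a block for the bit [true]. *)
Definition turn_matrix :=
  pebble_matrix (cB :: cB :: blocksr (true :: rev (bits goal))) true [:: cB; cB; cB]
                [:: cA; cA; cA] [::].

(** The first two entries test facing runs for equality, the next two erase the rest of a right or a
    left run, the last four remove separators. Where both tops could be erased, the wrong choice
    leaves a configuration to which no further pop applies. *)
Definition pops : seq (bool * letters * letters) :=
  [:: (true, [:: cA; cB], [:: cA; cA]);
      (true, [:: cA; cA], [:: cA; cB]);
      (true, [:: cB; cB; cB], [:: cA]);
      (true, [:: cA], [:: cB]);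
      (false, [:: cB; cB], [:: cB; cB]);
      (false, [:: cB; cB; cA], [:: cB]);
      (false, [:: cB; cB; cA], [:: cA]);
      (false, [:: cB; cA], [:: cA])].

Definition pop_matrix (t : bool * letters * letters) :=
  pebble_matrix [::] t.1.1 [::] t.1.2 t.2.

(** Without any [cA] both halves are used up and the pebbles may go. This is the only matrix with
    both conditions. *)
Definition stop_matrix :=
  SCMMatrix [:: (None, [::]); (None, [::])] (Some (context [:: cB] [:: cB])) (Some [:: cA]).

(** Forbidding pebbles protects the separators until the comparison is over. *)
Definition clean_matrix : scm_matrix T (option bool) :=
  SCMMatrix [:: (Some false, [::])] None (Some [:: cD]).

Definition grammar : seq (scm_matrix T (option bool)) :=
  [:: turn_matrix; stop_matrix; clean_matrix] ++ map pop_matrix pops ++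
  map init_matrix ([::] :: [seq [:: a] | a <- enum T]) ++
  map (fun ab => terminal_matrix ab.1 ab.2) (enum {: T * T}) ++
  map piece_matrix (pieces R).

Variant grammar_spec (M : scm_matrix T (option bool)) : Prop :=
  | IsTurn of M = turn_matrix
  | IsStop of M = stop_matrix
  | IsClean of M = clean_matrix
  | IsPop t of List.In t pops & M = pop_matrix t
  | IsInit w of size w <= 1 & M = init_matrix w
  | IsTerminal a b of M = terminal_matrix a b
  | IsPiece p of p \in pieces R & M = piece_matrix p.

Lemma grammarP M : List.In M grammar <-> grammar_spec M.
Proof.
rewrite /grammar !In_cat !In_map; split.
  case=> [[<-|[<-|[<-|[]]]]|[[t tp ->]|[[w hw ->]|[[[a b] _ ->]|[p /In_mem pR ->]]]]].
  - exact: IsTurn. - exact: IsStop. - exact: IsClean. - exact: (IsPop tp).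
  - apply: (@IsInit _ w) => //; case: hw => [<- //|/In_map [a _ ->]]; exact: leqnn.
  - exact: IsTerminal.
  - exact: (IsPiece pR).
case=> [->|->|->|t tp ->|w hw ->|a b ->|p pR ->]; try by left; rewrite /=; auto.
- by right; left; exists t.
- right; right; left; exists w => //; case: w hw => [|a [|//]] _; first by left.
  by right; apply/In_map; exists a => //; apply/In_mem; rewrite mem_enum.
- right; right; right; left; exists (a, b) => //.
  by apply/In_mem; rewrite mem_enum.
- by right; right; right; right; exists p => //; apply/In_mem.
Qed.

(** A context shows at most four symbols besides the two pebbles, and every forbidden word is a
    single symbol. *)
Lemma grammar_bounds :
  [/\ forall r, List.In r grammar -> wf_matrix r,
      forall r, List.In r grammar -> cond_size (mx_perm r) <= 6 /\ cond_size (mx_forb r) <= 3,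
      forall r, List.In r grammar -> size (mx_rules r) <= 2 &
      count (@nonsimple T (option bool)) grammar <= 4].
Proof.
split=> [r|r|r|].
- by case/grammarP => [->|->|->|t [<-|[<-|[<-|[<-|[<-|[<-|[<-|[<-|[]]]]]]]]] ->|
    w hw ->|a b ->|p pR ->];
    split=> //; split=> // _ [<-].
- by case/grammarP => [->|->|->|t [<-|[<-|[<-|[<-|[<-|[<-|[<-|[<-|[]]]]]]]]] ->|
    w hw ->|a b ->|p pR ->].
- by case/grammarP => [->|->|->|t [<-|[<-|[<-|[<-|[<-|[<-|[<-|[<-|[]]]]]]]]] ->|
    w hw ->|a b ->|p pR ->].
have simple X (f : X -> scm_matrix T (option bool)) (s : seq X) :
    (forall x, ~~ nonsimple (f x)) -> count (@nonsimple T (option bool)) (map f s) = 0.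
  by move=> h; elim: s => //= x s ->; rewrite (negbTE (h x)).
by rewrite /grammar !count_cat !simple.
Qed.

(** [z] is the common part cancelled so far. The leading [true] on the left is the former marker;
    [turn_matrix] writes its counterpart on the right. *)
Definition matched (w : seq T) (x y : seq bool) : Prop :=
  exists2 ps, {subset ps <= pieces R} &
  exists z, true :: rev (bits (start w ++ tops ps)) = z ++ x /\
            (true :: rev (bits goal)) ++ rev (bits (bots ps)) = z ++ y.

Lemma matched_cons w b x y : matched w (b :: x) (b :: y) -> matched w x y.
Proof. by case=> ps sub [z [e1 e2]]; exists ps => //; exists (rcons z b); rewrite !cat_rcons. Qed.

Lemma matched_nil w : matched w [::] [::] -> accepted S R w.
Proof.
case=> ps sub [z []]; rewrite cats0 => <- e; exists ps; split=> //.
apply: (@bits_inj T N); apply: (can_inj revK); move: e.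
by rewrite /= -rev_cat -bits_cat => -[<-].
Qed.

(** Possible numbers of [cB] on top of the two stacks. The pairs [(1, 1)] and [(2, 0)] arise only
    under a context showing a [cA] below the left separator, and [(1, 0)] under one that also shows
    a [cA] on the right; hence the nonemptiness tests. *)
Definition separators (x y : seq bool) : seq (nat * nat) :=
  [:: (3, 2); (2, 2); (3, 1); (1, 2); (2, 1)] ++
  (if x is _ :: _ then [:: (1, 1); (2, 0)] ++ (if y is _ :: _ then [:: (1, 0)] else [::])
   else [::]).

Definition right (y : seq bool) (w : seq T) : letters := blocksr y ++ map inl w.

(* In [Sep] separators are being removed; in [Runs] two runs face each other; in
   [RunLeft] and [RunRight] one of two runs of equal bits is exhausted; [Stuck]
   has no successor. *)
Variant cancelling (w : seq T) : letters -> letters -> Prop :=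
  | Sep i j x y of matched w x y & (i, j) \in separators x y :
      cancelling w (nseq i cB ++ blocksl x) (nseq j cB ++ right y w)
  | Runs b c x y of matched w (b :: x) (c :: y) :
      cancelling w (blocksl (b :: x)) (right (c :: y) w)
  | RunLeft p x y of matched w x y & 0 < p < 3 :
      cancelling w (nseq p cA ++ nseq 3 cB ++ blocksl x) (nseq 2 cB ++ right y w)
  | RunRight q x y of matched w x y & 0 < q < 3 :
      cancelling w (nseq 3 cB ++ blocksl x) (nseq q cA ++ nseq 2 cB ++ right y w)
  | Stuck x y :
      cancelling w (blocksl (false :: x)) (right (true :: y) w).

Lemma count_blocksl x : count_mem cD (blocksl x) = 0.
Proof. by elim: x => //= -[] x IH /=; rewrite IH. Qed.

Lemma count_blocksr x : count_mem cD (blocksr x) = 0.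
Proof. by elim: x => //= -[] x IH /=; rewrite IH. Qed.

Lemma count_right y w : count_mem cD (right y w) = 0.
Proof. by rewrite /right count_cat count_blocksr; elim: w. Qed.

Lemma separators_cons i j x y : (i, j) \in separators x y ->
  [\/ (i, j) \in [:: (3, 2); (2, 2); (3, 1); (1, 2); (2, 1)],
      (exists b x', x = b :: x') /\ (i, j) \in [:: (1, 1); (2, 0)] |
      [/\ exists b x', x = b :: x', exists c y', y = c :: y' & (i, j) = (1, 0)]].
Proof.
rewrite /separators mem_cat => /orP [h|]; first exact: Or31.
case: x => [|b x] //; rewrite mem_cat => /orP [h|].
  by apply: Or32; split=> //; exists b, x.
case: y => [|c y] //; rewrite inE => /eqP e; apply: Or33; split=> //.
- by exists b, x.
- by exists c, y.
Qed.

Lemma cancelling_config w l r : cancelling w l r ->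
  [/\ pebble_free l, pebble_free r & 1 < count_mem cB (config l r)].
Proof.
have cfg a b : 1 < count_mem cB a + count_mem cB b -> 1 < count_mem cB (config a b).
  by rewrite /config count_cat count_rev.
have ns k b x : count_mem cD x = 0 -> count_mem cD (nseq k (inr (Some b)) ++ x) = 0.
  by rewrite count_cat count_nseq => ->.
have hl := count_blocksl; have hr := count_right.
case=> [i j x y _ h|b c x y _|p x y _ h|q x y _ h|x y];
  split; rewrite ?pebble_freeE ?ns //; try (apply: cfg; rewrite ?count_cat).
- rewrite !count_nseq /= !mul1n; case/separators_cons: h => [|[[b [x1 ->]] _]|[[b [x1 ->]] _ [-> ->]]].
  + rewrite !inE !xpair_eqE => /or4P [|||/orP []] /andP [/eqP -> /eqP ->];
      by rewrite ?addnS ?addSn.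
  + by case: b; rewrite /= ?add0n ?add1n ?addnS ?addSn !ltnS.
  + by case: b; rewrite /= ?add0n ?add1n ?addnS ?addSn !ltnS.
- by case: b; rewrite /= hl.
- by case: c; rewrite /right /= hr.
- by case: b; rewrite /= ?addnS ?addSn.
- by rewrite /= !addnS !addSn.
- by rewrite /= !addnS !addSn.
- by rewrite /= hl.
- by rewrite /right /= hr.
- by rewrite /= ?addnS ?addSn.
Qed.

(** Left runs have at most two letters [cA], so neither a generating matrix nor a second turn can
    interfere with cancelling. *)
Lemma cancelling_unmarked w l r : cancelling w l r -> forall s, l <> [:: cA; cA; cA] ++ s.
Proof.
case=> [i j x y _ /separators_cons [h|[_ h]|[_ _ [-> _]]]|b c x y _|p x y _ h|q x y _ _|x y] s //.
- by move: h; rewrite !inE !xpair_eqE => /or4P [|||/orP []] /andP [/eqP -> _].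
- by move: h; rewrite !inE !xpair_eqE => /orP [] /andP [/eqP -> _].
- by case: b.
- by case: p h => [|[|[|]]].
Qed.

Ltac pop_cases w el er :=
  case=> [[<- <- <-]|[[<- <- <-]|[[<- <- <-]|[[<- <- <-]|
      [[<- <- <-]|[[<- <- <-]|[[<- <- <-]|[[<- <- <-]|[]]]]]]]]] el er;
  try discriminate el; try discriminate er; try (by case: (w) er);
  (split=> z; try done; case=> <-).

(** Facing runs fit a context only if their bits agree. Erasing from the shorter run exhausts it;
    erasing from the longer one leaves a single [cA] on each side, which is [Stuck]. *)
Lemma cancelling_pop w l r x p q s t : cancelling w l r -> List.In (x, p, q) pops ->
  l = p ++ s -> r = q ++ t ->
  (forall z, l = inr (Some x) :: z -> cancelling w z r) /\
  (forall z, r = inr (Some x) :: z -> cancelling w l z).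
Proof.
case=> [i j a b m h|b c a e m|k a b m h|k a b m h|a b].
- have {h} : [\/ (i, j) = (3, 2), (i, j) = (2, 2), (i, j) = (3, 1) |
               (i, j) = (1, 2) \/ (i, j) = (2, 1)] \/
   (exists d a1, a = d :: a1 /\ ((i, j) = (1, 1) \/ (i, j) = (2, 0))) \/
   (exists d a1 f b1, [/\ a = d :: a1, b = f :: b1 & (i, j) = (1, 0)]).
    case/separators_cons: h => [h|[[d [a1 ->]] h]|[[d [a1 ->]] [f [b1 ->]] ->]].
    + left; move: h; rewrite !inE => /or4P [|||/orP []] /eqP ->;
        by [apply: Or41|apply: Or42|apply: Or43|apply: Or44; left|apply: Or44; right].
    + right; left; exists d, a1; split=> //; move: h; rewrite !inE => /orP [] /eqP ->; by [left|right].
    + by right; right; exists d, a1, f, b1.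
  case=> [h|[[d [a1 [ea h]]]|[d [a1 [f [b1 [ea eb [-> ->]]]]]]]].
  + case: a m => [|[] a] m; (case: h => [[-> ->]|[-> ->]|[-> ->]|[[-> ->]|[-> ->]]]);
    case: b m => [|[] b] m; pop_cases w el er;
    first [exact: (@Sep w 2 2 _ _ m isT)|exact: (@Sep w 3 1 _ _ m isT)|
           exact: (@Sep w 1 2 _ _ m isT)|exact: (@Sep w 2 1 _ _ m isT)|
           exact: (@Sep w 1 1 _ _ m isT)|exact: (@Sep w 2 0 _ _ m isT)].
  + subst a; case: d m => m; (case: h => -[-> ->]); case: b m => [|[] b] m; pop_cases w el er;
    exact: (@Sep w 1 0 _ _ m isT).
  + by subst a b; case: d m => m; case: f m => m; pop_cases w el er; exact: Runs m.
- case: c m => m; case: b m => m; pop_cases w el er;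
    first [exact: (@RunRight w 2 _ _ (matched_cons m) isT)|
           exact: (@RunLeft w 2 _ _ (matched_cons m) isT)|exact: Stuck].
- by case: k h => [|[|[|//]]] // _; pop_cases w el er;
    first [exact: (@RunLeft w 1 _ _ m isT)|exact: (@Sep w 3 2 _ _ m isT)].
- by case: k h => [|[|[|//]]] // _; pop_cases w el er;
    first [exact: (@RunRight w 1 _ _ m isT)|exact: (@Sep w 3 2 _ _ m isT)].
- by pop_cases w el er.
Qed.

End Pebbles.

(** * Correctness of the grammar *)

Section Simulation.
Variables (T N : finType) (S : N) (R : seq (word T N * word T N)).

Notation letters := (word T (option bool)).
Notation cD := (@inr T (option bool) None).
Notation cA := (@inr T (option bool) (Some true)).
Notation cB := (@inr T (option bool) (Some false)).
Notation accepted := (accepted S R).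
Notation matched := (matched S R).
Notation cancelling := (cancelling S R).
Notation grammar := (grammar S R).
Notation bits := (@bits T N).
Notation goal := (goal T S).

(** * The invariant of the sentential forms *)

Definition generating (w : seq T) (ps : seq (piece T N)) : letters :=
  config (marker T (rev (bits (start N w ++ tops ps)))) (right (rev (bits (bots ps))) w).

(** One constructor for each phase of a derivation, and one for failure. [Cleaning] must record
    acceptance, since the two halves are gone by then. *)
Variant reached : letters -> Prop :=
  | Initial : reached [:: cD]
  | Generating w ps of {subset ps <= pieces R} : reached (generating w ps)
  | Cancelling w l r of cancelling w l r : reached (config l r)
  | Cleaning k w of accepted w : reached (nseq k cB ++ map inl w)
  | Dead u of dead u : reached u.

Lemma blocksl_cat x y : blocksl T (x ++ y) = blocksl T x ++ blocksl T y.
Proof. by elim: x => //= b x ->; rewrite -catA. Qed.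

Lemma blocksr_cat x y : blocksr T (x ++ y) = blocksr T x ++ blocksr T y.
Proof. by elim: x => //= b x ->; rewrite -catA. Qed.

Lemma marker_step x c s :
  marker T (rev (behead (bits (c :: s)))) ++ behead (marker T x) =
  marker T (rev (bits (c :: s)) ++ x).
Proof.
rewrite [in RHS]bits_head rev_cons cat_rcons /marker /= blocksl_cat.
by rewrite /=.
Qed.

Lemma right_step x y (w : seq T) : blocksr T x ++ right y w = right (x ++ y) w.
Proof. by rewrite /right blocksr_cat catA. Qed.

(** A word pushed on the right ends in [cB], so when the left pebble is the one replaced, no [cA] of
    that word is next to the remaining pebble. *)
Lemma rev_blocksr b x : exists z, rev (blocksr T (b :: x)) = cB :: z.
Proof.
elim: x b => [|c x IH] b; first by case: b; eexists.
by case: (IH c) => z e; rewrite [blocksr _ _]/= rev_cat !rev_cons e -!cats1; eexists.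
Qed.

Lemma pebble_free_blocksr x : pebble_free (blocksr T x).
Proof. by rewrite pebble_freeE count_blocksr. Qed.

Lemma pebble_free_right x (w : seq T) : pebble_free (right x w).
Proof. by rewrite pebble_freeE count_right. Qed.

Lemma pebble_free_marker x : pebble_free (marker T x).
Proof. by rewrite pebble_freeE /marker /= count_blocksl. Qed.

Lemma infix1 (X : eqType) (a : X) u : infix [:: a] u = (a \in u).
Proof.
apply/infixP/idP => [[b [c ->]]|]; first by rewrite mem_cat inE eqxx orbT.
by case/path.splitPr => b c; exists b, c.
Qed.

(** Apart from two matrices, all need adjacent pebbles; of these two, [init_matrix] is blocked by
    [cB] and [clean_matrix] by [cD]. *)
Lemma dead_final u r v : dead u -> List.In r grammar -> ~ scm_step r u v.
Proof.
move=> du /grammarP; have [uB [a [m [b [ue _ _ _ _]]]]] := du.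
have uD : cD \in u by rewrite ue mem_cat inE eqxx orbT.
have no p q : ~ infix (context p q) u by apply/negP; apply: dead_no_context.
case=> [->|->|->|t _ ->|w _ ->|c d ->|p _ ->] [hP [hF _]];
  try by apply: no (hP _ erefl).
- by move: (hF _ erefl); rewrite infix1 uD.
- by move: (hF _ erefl); rewrite infix1 uB.
Qed.

Lemma stop_step l r u : pebble_free l -> pebble_free r ->
  scm_step (stop_matrix T) (config l r) u ->
  [/\ exists s, l = cB :: s, exists s, r = cB :: s, cA \notin l, cA \notin r & u = rev l ++ r].
Proof.
move=> fl fr [/(_ _ erefl) /(infix_context _ _ fl fr) [hl hr]].
case=> [/(_ _ erefl)]; rewrite infix1 /config mem_cat mem_rev !inE /= negb_or => /andP [al ar].
case=> u1 [[a [b [/(config_split fl fr) e1 ->]]] [u2 [[c [d [e2 e3]]] <-]]]; split=> //.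
rewrite e3 {u e3} /=; have free x y : x ++ cD :: y = rev l ++ r -> False.
  by move/esym; apply: pebble_free_split; rewrite /pebble_free mem_cat mem_rev negb_or; apply/andP.
have {e1 e2} : c ++ cD :: d = rev l ++ cD :: r.
  by case: e1 e2 => [[-> ->]|[-> ->]] /= <-; rewrite ?cat_rcons.
move=> e; case: (cat_cons_eq e) => [[-> _ ->] //|[m el _]|[m _ er]].
  by have := @pebble_free_split T (rev l) c m; rewrite /pebble_free mem_rev => /(_ fl).
by case: (pebble_free_split fr er).
Qed.

Lemma cancelling_step w l r M u : cancelling w l r -> List.In M grammar ->
  scm_step M (config l r) u -> reached u.
Proof.
move=> can /grammarP inM st; have [fl fr cB2] := cancelling_config can.
have no v y q : scm_step (pebble_matrix v true y [:: cA; cA; cA] q) (config l r) u -> False.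
  case=> /(_ _ erefl) /(infix_context _ _ fl fr) [[s]] e _ _.
  exact: (cancelling_unmarked can e).
have hD : cD \in config l r by rewrite mem_cat inE eqxx orbT.
have hB : cB \in config l r by rewrite -has_pred1 has_count (ltnW cB2).
case: inM st => [->|->|->|[[x p] q] tp ->|v _ ->|c d ->|p _ ->]; try by move/no.
- case/(stop_step fl fr) => [[s el] [t er] al ar ->] {no hD hB fl fr cB2}.
  case: can el er al ar => [i j x y m _|b c x y _|k x y _ hk|k x y _ hk|x y] // el er.
  (* Any remaining block would contain a [cA], so both bit lists are empty. *)
  + case: x el m => [|b x] el m; last by rewrite mem_cat /= mem_cat; case: (b); rewrite ?inE ?orbT.
    case: y er m => [|c y] er m _; last first.
      by rewrite /right mem_cat /= !mem_cat; case: (c); rewrite ?inE ?orbT.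
    rewrite cats0 rev_nseq /right /= catA -nseqD => _.
    exact: Cleaning (matched_nil m).
  + by case: b el.
  + by case: k hk el => [|k].
  + by case: k hk er => [|k].
- by case=> _ [/(_ _ erefl)]; rewrite infix1 hD.
- case/(pebble_step _ _ fl fr cB2) => // [[s el] [t er]].
  have [hl hr] := cancelling_pop can tp el er.
  case=> [du|[z ez ->]|[z ez ->]|[_ [[z ez ->]|[z ez ->]]]]; first exact: Dead.
  + exact: Cancelling (hl _ ez). + exact: Cancelling (hl _ ez).
  + exact: Cancelling (hr _ ez). + exact: Cancelling (hr _ ez).
- by case=> _ [/(_ _ erefl)]; rewrite infix1 hB.
Qed.

Lemma right_inl x w (b : T) t : right x w = inl b :: t -> x = [::].
Proof. by case: x => // -[]. Qed.

Lemma generating_free w ps :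
  [/\ pebble_free (marker T (rev (bits (start N w ++ tops ps)))),
      pebble_free (right (rev (bits (bots ps))) w) &
      1 < count_mem cB (generating w ps)].
Proof.
split; [exact: pebble_free_marker|exact: pebble_free_right|].
by rewrite /generating /config count_cat count_rev /marker /= !addnS !addSn.
Qed.

Lemma gen_step (w : seq T) ps c s v q u (t := right (rev (bits (bots ps))) w) :
  pebble_free v -> (exists2 y, y <> cA & exists z, rev v = y :: z) ->
  scm_step (gen_matrix (c :: s) v q) (generating w ps) u ->
  [/\ exists z, t = q ++ z &
    dead u \/
    u = config (marker T (rev (bits (start N w ++ tops ps ++ c :: s)))) (v ++ t)].
Proof.
have [fl fr cB2] := generating_free w ps.
move=> fv [y yA [z ev]] /(pebble_step fv (pebble_free_marker _) fl fr cB2).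
case=> _ hq st; split=> //; case: st => [|[z' [<-] ->]|[z' e _]|[]//]; first by left.
  right; congr config.
  rewrite catA bits_cat rev_cat -marker_step /marker /=.
  by [].
by case: yA; move: e; rewrite ev => -[].
Qed.

Lemma bots_rcons ps (p : piece T N) : bots (rcons ps p) = bots ps ++ bot1 p.
Proof. by rewrite /bots map_rcons flatten_rcons. Qed.

Lemma tops_rcons ps (p : piece T N) : tops (rcons ps p) = tops ps ++ top1 p.
Proof. by rewrite /tops map_rcons flatten_rcons. Qed.

Lemma rcons_is_cons (X : Type) (s : seq X) c : exists d t, rcons s c = d :: t.
Proof. by case: s => [|d s]; do 2 eexists. Qed.

Lemma generating_step w ps M u : {subset ps <= pieces R} -> List.In M grammar ->
  scm_step M (generating w ps) u -> reached u.
Proof.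
move=> sub /grammarP inM st; have [fl fr cB2] := generating_free w ps.
have hD : cD \in generating w ps by rewrite mem_cat inE eqxx orbT.
have hB : cB \in generating w ps by rewrite -has_pred1 has_count (ltnW cB2).
case: inM st => [->|->|->|[[x p] q] tp ->|v _ ->|c d ->|p pR ->].
- have fv : pebble_free (cB :: cB :: blocksr T (true :: rev (bits goal))).
    exact: pebble_free_blocksr (true :: rev (bits goal)).
  case/(pebble_step fv _ fl fr cB2) => // _ _.
  case=> [du|[z [<-] ->]|[z e _]|[]//]; first exact: Dead.
    rewrite -[_ ++ right _ _]/(cB :: cB :: (blocksr T (true :: rev (bits goal)) ++ _)) right_step.
    apply: (@Cancelling w).
    apply: (@Sep T N S R w 3 2 (true :: rev (bits (start N w ++ tops ps)))
       (true :: rev (bits goal) ++ rev (bits (bots ps)))) => //.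
    exists ps => //; exists [::]; split=> //.
  by case: (rev_blocksr true (rev (bits goal))) => z' e'; move: e; rewrite 2!rev_cons e' -!cats1.
- by case/(stop_step fl fr) => [[s]].
- by case=> _ [/(_ _ erefl)]; rewrite infix1 hD.
- case/(pebble_step _ _ fl fr cB2) => // -[s el] [t er] _.
  (* As every code ends in [false], the right stack starts with two letters [cA] unless it holds
     only terminals. Facing three letters [cA] on the left, neither fits a pop context. *)
  have [e|[y e]] : rev (bits (bots ps)) = [::] \/ exists y, rev (bits (bots ps)) = false :: y.
    case: (lastP ps) => [|ps' p']; [by left|right].
    rewrite bots_rcons bits_cat rev_cat.
    by have [y ->] := rev_bits_head (mirror p'.1.2) p'.2; eexists.
  - rewrite e in er.
    by case: tp el er => [[<- <- <-]|[[<- <- <-]|[[<- <- <-]|[[<- <- <-]|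
      [[<- <- <-]|[[<- <- <-]|[[<- <- <-]|[[<- <- <-]|[]]]]]]]]] // _; case: (w).
  - rewrite e in er.
    by case: tp el er => [[<- <- <-]|[[<- <- <-]|[[<- <- <-]|[[<- <- <-]|
      [[<- <- <-]|[[<- <- <-]|[[<- <- <-]|[[<- <- <-]|[]]]]]]]]].
- by case=> _ [/(_ _ erefl)]; rewrite infix1 hB.
- have hv : exists2 y, y <> cA & exists z, rev [:: @inl T (option bool) c] = y :: z.
    by exists (inl c) => //; exists [::].
  case/(gen_step _ hv) => // -[z /right_inl e0] [|->]; first exact: Dead.
  have eps : ps = [::].
    case: (lastP ps) e0 => // ps' p'; rewrite bots_rcons bits_cat rev_cat.
    by have [y ->] := rev_bits_head (mirror p'.1.2) p'.2.
  have -> : start N w ++ tops ps ++ [:: Some (inl c)] = start N (c :: w) ++ @tops T N [::].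
    by rewrite eps cats0 /start /mirror rev_cons map_rcons -cats1.
  by rewrite eps; apply: (@Generating (c :: w) [::]).
- have [c [s e]] := rcons_is_cons (mirror p.1.1) p.2.
  have hv : exists2 y, y <> cA & exists z, rev (blocksr T (rev (bits (bot1 p)))) = y :: z.
    have [z ->] := rev_bits_head (mirror p.1.2) p.2.
    by have [z' ->] := rev_blocksr false z; exists cB => //; exists z'.
  rewrite /piece_matrix /top1 e => /(gen_step (pebble_free_blocksr _) hv) [_ [|->]].
    exact: Dead.
  rewrite right_step -rev_cat -bits_cat -bots_rcons -e -/(top1 p) -tops_rcons.
  apply: Generating => p'; rewrite mem_rcons inE => /predU1P [->//|]; exact: sub.
Qed.

Lemma generating_nil w :
  generating w [::] = config (marker T (rev (bits (start N w)))) (map inl w).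
Proof. by rewrite /generating /tops /= cats0. Qed.

Lemma initial_step M u : List.In M grammar -> scm_step M [:: cD] u -> reached u.
Proof.
have no p q : ~ infix (context p q) [:: cD].
  by move/size_infix; rewrite /context size_cat /= !addnS.
move=> /grammarP [->|->|->|t _ ->|w _ ->|c d ->|p _ ->] [hP [hF]];
  try by case: (no _ _ (hP _ erefl)).
- by move: (hF _ erefl); rewrite infix1 inE eqxx.
- case=> u1 [[[|a p] [s [e ->]]] <-]; last by case: p e.
  case: e => <-; rewrite cats0 -generating_nil.
  by apply: (@Generating w [::]) => p; rewrite in_nil.
Qed.

Lemma cleaning_rewrite k (w : seq T) p s : nseq k cB ++ map inl w = p ++ cB :: s ->
  p ++ s = nseq k.-1 cB ++ map inl w.
Proof.
have nB : cB \notin map inl w by elim: (w).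
elim: k p => [|k IH] [|a p] //= e.
- by case: w e {nB}.
- by move: nB; rewrite e inE mem_cat inE eqxx !orbT.
- by case: e.
- case: e => <- e; rewrite (IH _ e); case: k e {IH} => //= e.
  by move: nB; rewrite e mem_cat inE eqxx !orbT.
Qed.

Lemma cleaning_step k w M u : accepted w -> List.In M grammar ->
  scm_step M (nseq k cB ++ map inl w) u -> reached u.
Proof.
move=> acc; have fD : cD \notin nseq k cB ++ map inl w.
  by rewrite mem_cat mem_nseq andbF; elim: (w).
have no p q : ~ infix (context p q) (nseq k cB ++ map inl w).
  case/infixP => a [b]; rewrite /context -!catA /= catA.
  exact: pebble_free_split.
move=> /grammarP [->|->|->|t _ ->|v _ ->|c d ->|p _ ->] [hP [hF]];
  try by case: (no _ _ (hP _ erefl)).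
- case=> u1 [[p [s [/cleaning_rewrite e ->]]] <-].
  by rewrite /= e; apply: Cleaning.
- case=> u1 [[p [s [/pebble_free_split]]]].
  by case.
Qed.

Lemma reached_step u v : reached u ->
  (exists2 M, List.In M grammar & scm_step M u v) -> reached v.
Proof.
case=> [|w ps sub|w l r can|k w acc|x dx] [M inM st].
- exact: initial_step inM st.
- exact: generating_step sub inM st.
- exact: cancelling_step can inM st.
- exact: cleaning_step acc inM st.
- by case: (dead_final dx inM st).
Qed.

Lemma reached_terminal w : reached (map inl w) -> accepted w.
Proof.
have free : pebble_free (map inl w : letters) by rewrite /pebble_free; elim: (w).
have no l r : config l r <> map inl w by move/esym; apply: pebble_free_split.
case e: {1}_ / => [|v ps sub|v l r can|k v acc|x [_ [a [m [b [ex _ _ _ _]]]]]].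
- by case: (w) e.
- by case: (no _ _ (esym e)).
- by case: (no _ _ (esym e)).
- case: k e => [/= e|k]; last by case: (w).
  suff -> : w = v by [].
  by apply: inj_map e => ? ? [].
- by move: free; rewrite /pebble_free e ex mem_cat inE eqxx orbT.
Qed.

(** * Derivations of accepted words *)

Notation derives := (scm_derives grammar).

Lemma derives_step M u v : grammar_spec S R M -> scm_step M u v -> derives u v.
Proof. by move=> /grammarP inM st; apply: rtc_one; exists M. Qed.

Lemma derives_generating0 w : derives [:: cD] (generating w [::]).
Proof.
have init v : size v <= 1 -> derives [:: cD] (generating v [::]).
  move=> v1; apply: derives_step (IsInit _ _ v1 erefl) _; split=> //; split.
    by move=> _ [<-]; rewrite infix1.
  exists (generating v [::]); split=> //; exists [::], [::]; split=> //.
  by rewrite generating_nil /= cats0.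
elim: w => [|a [|b w] IH]; [exact: init|exact: init|].
apply: rtc_trans IH _; apply: derives_step (@IsTerminal _ _ _ _ _ a b erefl) _.
rewrite generating_nil (_ : generating (a :: b :: w) [::] =
  config (marker T (rev (behead (bits [:: Some (inl a)]))) ++
          behead (marker T (rev (bits (start N (b :: w)))))) (inl a :: map inl (b :: w))).
  apply: (@pebble_left T [:: inl a] true) => //; first exact: pebble_free_marker.
  by rewrite /pebble_free; elim: (b :: w).
rewrite marker_step -rev_cat -bits_cat generating_nil; congr (config (marker _ (rev (bits _))) _).
by rewrite /start /mirror map_cons rev_cons map_rcons -cats1.
Qed.

Lemma derives_generating w ps : {subset ps <= pieces R} -> derives [:: cD] (generating w ps).
Proof.
elim/last_ind: ps => [|ps p IH] sub; first exact: derives_generating0.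
apply: rtc_trans (IH _) _ => [p' p'ps|]; first by apply: sub; rewrite mem_rcons inE p'ps orbT.
apply: (@derives_step (piece_matrix p)).
  by apply: (@IsPiece _ _ _ _ _ p) => //; apply: sub; rewrite mem_rcons mem_head.
have [c [s e]] := rcons_is_cons (mirror p.1.1) p.2.
have -> : generating w (rcons ps p) =
    config (marker T (rev (behead (bits (top1 p)))) ++
            behead (marker T (rev (bits (start N w ++ tops ps)))))
           (blocksr T (rev (bits (bot1 p))) ++ right (rev (bits (bots ps))) w).
  rewrite right_step -rev_cat -bits_cat -bots_rcons {1}/top1 e marker_step -rev_cat -bits_cat.
  by rewrite -e -/(top1 p) -catA -tops_rcons.
by apply: (@pebble_left T _ true) => //; [exact: pebble_free_marker|exact: pebble_free_right].
Qed.

Lemma derives_pop_left x p q l r s t : List.In (x, p, q) (pops T) ->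
  pebble_free l -> pebble_free r -> inr (Some x) :: l = p ++ s -> r = q ++ t ->
  derives (config (inr (Some x) :: l) r) (config l r).
Proof.
move=> tp fl fr el er; apply: derives_step (@IsPop _ _ _ _ _ _ tp erefl) _.
exact: (@pebble_left T [::] x [::] p q l r s t).
Qed.

Lemma derives_pop_right x p q l r s t : List.In (x, p, q) (pops T) ->
  pebble_free l -> pebble_free r -> l = p ++ s -> inr (Some x) :: r = q ++ t ->
  derives (config l (inr (Some x) :: r)) (config l r).
Proof.
move=> tp fl fr el er; apply: derives_step (@IsPop _ _ _ _ _ _ tp erefl) _.
exact: pop_right el er.
Qed.

Lemma derives_cancel x w :
  derives (config (nseq 3 cB ++ blocksl T x) (nseq 2 cB ++ right x w))
          (config (nseq 3 cB) (nseq 2 cB ++ map inl w)).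
Proof.
elim: x => [|b x IH]; first exact: rtc_refl.
have fl i a y : pebble_free (nseq i (inr (Some a)) ++ blocksl T y).
  by rewrite pebble_freeE count_cat count_nseq count_blocksl.
have fr i a y : pebble_free (nseq i (inr (Some a)) ++ right y w).
  by rewrite pebble_freeE count_cat count_nseq count_right.
have L y p q l r l' : List.In (y, p, q) (pops T) -> l' = inr (Some y) :: l ->
    pebble_free l -> pebble_free r -> (exists s, l' = p ++ s) -> (exists t, r = q ++ t) ->
    derives (config l' r) (config l r).
  by move=> tp -> fl' fr' [s es] [t et]; apply: derives_pop_left tp fl' fr' es et.
have Q y p q l r r' : List.In (y, p, q) (pops T) -> r' = inr (Some y) :: r ->
    pebble_free l -> pebble_free r -> (exists s, l = p ++ s) -> (exists t, r' = q ++ t) ->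
    derives (config l r') (config l r).
  by move=> tp -> fl' fr' [s es] [t et]; apply: derives_pop_right tp fl' fr' es et.
apply: rtc_trans _ IH.
(* The separators shrink through [(3, 2)], [(2, 2)], [(2, 1)], [(2, 0)], [(1, 0)] and [(0, 0)], the
   only order that exposes both runs. *)
pose C i j := config (nseq i cB ++ blocksl T (b :: x)) (nseq j cB ++ right (b :: x) w).
have c1 : derives (C 3 2) (C 2 2).
  by apply: (L false [:: cB; cB] [:: cB; cB]) => //; [rewrite /=; tauto|eexists|eexists].
have c2 : derives (C 2 2) (C 2 1).
  by apply: (Q false [:: cB; cB] [:: cB; cB]) => //; [rewrite /=; tauto|eexists|eexists].
have c3 : derives (C 2 1) (C 2 0).
  by apply: (Q false [:: cB; cB; cA] [:: cB]) => //; [rewrite /=; tauto|case: (b); eexists|eexists].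
have c4 : derives (C 2 0) (C 1 0).
  by apply: (L false [:: cB; cB; cA] [:: cA]) => //; [rewrite /=; tauto|case: (b); eexists|case: (b); eexists].
have c5 : derives (C 1 0) (C 0 0).
  by apply: (L false [:: cB; cA] [:: cA]) => //; [rewrite /=; tauto|case: (b); eexists|case: (b); eexists].
apply: rtc_trans c1 _; apply: rtc_trans c2 _; apply: rtc_trans c3 _.
apply: rtc_trans c4 _; apply: rtc_trans c5 _; rewrite /C {C}.
have gl i : pebble_free (nseq i cA ++ nseq 3 cB ++ blocksl T x).
  by rewrite pebble_freeE !count_cat !count_nseq count_blocksl.
have gr j : pebble_free (nseq j cA ++ nseq 2 cB ++ right x w).
  by rewrite /pebble_free mem_cat mem_nseq andbF; exact: fr.
(* The shorter run is erased first, then the longer one. *)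
pose D i j := config (nseq i cA ++ nseq 3 cB ++ blocksl T x) (nseq j cA ++ nseq 2 cB ++ right x w).
case: b.
- have d1 : derives (D 2 1) (D 2 0).
    by apply: (Q true [:: cA; cA] [:: cA; cB]) => //; [rewrite /=; tauto|eexists|eexists].
  have d2 : derives (D 2 0) (D 1 0).
    by apply: (L true [:: cA] [:: cB]) => //; [rewrite /=; tauto|eexists|eexists].
  have d3 : derives (D 1 0) (D 0 0).
    by apply: (L true [:: cA] [:: cB]) => //; [rewrite /=; tauto|eexists|eexists].
  exact: rtc_trans d1 (rtc_trans d2 d3).
- have d1 : derives (D 1 2) (D 0 2).
    by apply: (L true [:: cA; cB] [:: cA; cA]) => //; [rewrite /=; tauto|eexists|eexists].
  have d2 : derives (D 0 2) (D 0 1).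
    by apply: (Q true [:: cB; cB; cB] [:: cA]) => //; [rewrite /=; tauto|eexists|eexists].
  have d3 : derives (D 0 1) (D 0 0).
    by apply: (Q true [:: cB; cB; cB] [:: cA]) => //; [rewrite /=; tauto|eexists|eexists].
  exact: rtc_trans d1 (rtc_trans d2 d3).
Qed.

Lemma derives_clean k w : derives (nseq k cB ++ map inl w) (map inl w).
Proof.
elim: k => [|k IH]; first exact: rtc_refl.
apply: rtc_trans _ IH; apply: derives_step (IsClean _ _ erefl) _; split=> //; split.
  by move=> _ [<-]; rewrite infix1 mem_cat mem_nseq andbF; elim: (w).
by exists (nseq k cB ++ map inl w); split=> //; exists [::], (nseq k cB ++ map inl w).
Qed.

Lemma grammar_correct w : scm_generates grammar None w <-> accepted w.
Proof.
split=> [d|[ps [sub e]]].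
  apply: reached_terminal; apply: rtc_invariant d _; [exact: reached_step|exact: Initial].
apply: rtc_trans (derives_generating w sub) _.
pose x := true :: rev (bits (start N w ++ tops ps)).
apply: (rtc_trans (y := config (nseq 3 cB ++ blocksl T x) (nseq 2 cB ++ right x w))).
  have -> : right x w =
      blocksr T (true :: rev (bits goal)) ++ right (rev (bits (bots ps))) w.
    by rewrite right_step /x e bits_cat rev_cat.
  apply: derives_step (IsTurn _ erefl) _.
  apply: (@pebble_left T (cB :: cB :: blocksr T (true :: rev (bits goal))) true) => //.
    exact: pebble_free_marker. exact: pebble_free_right.
(* The last separators, three letters on the left and two on the right, leave five letters [cB] to
   clean. *)
apply: rtc_trans (derives_cancel _ _) _; apply: rtc_trans _ (derives_clean 5 w).
apply: derives_step (IsStop _ _ erefl) _; split=> [_ [<-]|].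
  apply/infix_context; [by []|by rewrite /pebble_free; elim: (w)|].
  by split; eexists.
split=> [_ [<-]|]; first by rewrite infix1; elim: (w).
exists (rev (nseq 3 cB) ++ cD :: nseq 2 cB ++ map inl w); split.
  by exists (rev (nseq 3 cB)), (cD :: nseq 2 cB ++ map inl w).
exists (nseq 5 cB ++ map inl w); split=> //.
by exists (rev (nseq 3 cB)), (nseq 2 cB ++ map inl w).
Qed.

End Simulation.

Lemma RE_SCM (T : finType) (L : seq T -> Prop) : RE L -> SCM 6 3 3 None 2 4 L.
Proof.
case=> N [S [R [_ LR]]]; exists (option bool), None, (grammar S R).
have [wf deg len ns] := grammar_bounds S R.
split=> //; first by rewrite card_option card_bool.
by move=> w; rewrite LR grammar_correct acceptedP.
Qed.

(** * Simulating matrices by phrase-structure rules *)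

(** There are finitely many words of length at most [B], and excluded middle filters their pairs.
    Rules can thus be specified by a predicate instead of a list. *)
Lemma bounded_relation_list (X : finType) (E : seq X -> seq X -> Prop) (B : nat) :
  (forall u v, E u v -> size u <= B /\ size v <= B) ->
  exists R, forall u v, List.In (u, v) R <-> E u v.
Proof.
move=> bE; pose words := [seq val t | n <- iota 0 B.+1, t <- enum {: n.-tuple X}].
have wordsP u : size u <= B -> u \in words.
  move=> su; apply/allpairsPdep; exists (size u), (in_tuple u).
  by rewrite mem_iota /= add0n ltnS mem_enum.
pose decide (p : seq X * seq X) : bool :=
  if excluded_middle_informative (E p.1 p.2) then true else false.
exists [seq p <- [seq (u, v) | u <- words, v <- words] | decide p] => u v.
rewrite In_mem mem_filter /decide /=; case: excluded_middle_informative => /= Euv; last by split.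
have [su sv] := bE _ _ Euv; split=> // _.
by apply/allpairsP; exists (u, v); split; rewrite ?wordsP.
Qed.

Section HeadGrammar.
Variables (T N : finType) (S : N) (M : seq (scm_matrix T N)).

Definition matrix_at (i : nat) := nth (SCMMatrix [::] None None) M i.

Lemma In_matrix_at r : List.In r M <-> exists i : 'I_(size M), r = matrix_at i.
Proof.
split=> [|[[i Hi] ->]].
  rewrite /matrix_at; elim: M => //= r' M' IH [->|/IH [i ->]]; first by exists ord0.
  by exists (lift ord0 i).
rewrite /matrix_at /=; elim: M i Hi => //= r' M' IH [|i] Hi; [by left|right; exact: IH].
Qed.

Definition max_rules := \max_(i < size M) size (mx_rules (matrix_at i)).

Definition head_state := option (option
  ('I_(size M) * option (option 'I_max_rules.+1))).
Definition output : head_state := None.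
Definition idle : head_state := Some None.
Definition permitted i : head_state := Some (Some (i, None)).
Definition scanning i : head_state := Some (Some (i, Some None)).
Definition applying i k : head_state := Some (Some (i, Some (Some k))).

(** A scanning head that moved freely could skip an occurrence, and the output head may advance only
    by converting cells. *)
Definition free (q : head_state) : bool :=
  match q with None | Some (Some (_, Some None)) => false | _ => true end.

Definition nonterminal := ((T + N) + (head_state + option bool))%type.
Notation letters := (word T nonterminal).

(** Even terminals are stored as nonterminals until the output phase converts them. *)
Definition cell (s : T + N) : sym T nonterminal := inr (inl s).
Definition head (q : head_state) : sym T nonterminal := inr (inr (inl q)).
Definition start_symbol : nonterminal := inr (inr None).
Definition lend : sym T nonterminal := inr (inr (inr (Some false))).
Definition rend : sym T nonterminal := inr (inr (inr (Some true))).
Definition cells (x : word T N) : letters := map cell x.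

(** An absent condition becomes the empty word, a factor of every word. *)
Definition permitting (i : 'I_(size M)) : word T N := odflt [::] (mx_perm (matrix_at i)).

(* [head_rule a q b c] stands for the rule a (head q) b -> c. *)
Inductive head_rule : letters -> head_state -> letters -> letters -> Prop :=
  | MoveRight q s of free q : head_rule [::] q [:: cell s] [:: cell s; head q]
  | MoveLeft q s of free q : head_rule [:: cell s] q [::] [:: head q; cell s]
  | Permit i : head_rule [::] idle (cells (permitting i))
      (head (permitted i) :: cells (permitting i))
  | NoForbidden (i : 'I_(size M)) of mx_forb (matrix_at i) = None :
      head_rule [::] (permitted i) [::] [:: head (applying i ord0)]
  | ScanStart i : head_rule [:: lend] (permitted i) [::] [:: lend; head (scanning i)]
  | ScanMove (i : 'I_(size M)) w s x of mx_forb (matrix_at i) = Some w & size w = (size x).+1 & s :: x <> w :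
      head_rule [::] (scanning i) (cells (s :: x)) (cell s :: head (scanning i) :: cells x)
  | ScanEnd (i : 'I_(size M)) w x of mx_forb (matrix_at i) = Some w & size x < size w :
      head_rule [::] (scanning i) (rcons (cells x) rend)
                (head (applying i ord0) :: rcons (cells x) rend)
  | Apply (i : 'I_(size M)) (k k' : 'I_max_rules.+1) A x rs of drop k (mx_rules (matrix_at i)) = (A, x) :: rs &
      k' = k.+1 :> nat :
      head_rule [::] (applying i k) [:: cell (inr A)] (head (applying i k') :: cells x)
  | Applied (i : 'I_(size M)) (k : 'I_max_rules.+1) of size (mx_rules (matrix_at i)) = k :
      head_rule [::] (applying i k) [::] [:: head idle]
  | OutputStart : head_rule [:: lend] idle [::] [:: head output]
  | OutputLetter a : head_rule [::] output [:: cell (inl a)] [:: inl a; head output]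
  | OutputEnd : head_rule [::] output [:: rend] [::].

Definition rule (x y : letters) : Prop :=
  (x = [:: inr start_symbol] /\ y = [:: lend; head idle; cell (inr S); rend]) \/
  exists a q b, head_rule a q b y /\ x = a ++ head q :: b.

Lemma rule_bounded : exists B, forall x y, rule x y -> size x <= B /\ size y <= B.
Proof.
pose p := \max_(i < size M) size (permitting i).
pose f := \max_(i < size M) cond_size (mx_forb (matrix_at i)).
pose s := \max_(i < size M) sumn [seq size (r : N * word T N).2 | r <- mx_rules (matrix_at i)].
have hp i : size (permitting i) <= p by apply: (leq_bigmax i).
have hf (i : 'I_(size M)) w : mx_forb (matrix_at i) = Some w -> size w <= f.
  by move=> e; have := leq_bigmax (F := fun i : 'I_(size M) => cond_size (mx_forb (matrix_at i))) i; rewrite e.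
have hs (i : 'I_(size M)) k A x rs : drop k (mx_rules (matrix_at i)) = (A, x) :: rs -> size x <= s.
  move=> e; apply: leq_trans (leq_bigmax (F := fun i : 'I_(size M) => sumn [seq size (r : N * word T N).2 | r <- mx_rules (matrix_at i)]) i).
  by rewrite -[mx_rules _](cat_take_drop k) e map_cat sumn_cat /=; lia.
exists (p + f + s + 4) => x y [[-> ->]|[a [q [b [hr ->]]]]]; first by rewrite /=; lia.
case: hr => [q' c _|q' c _|i|i _|i|i w c z /hf ew e _|i w z /hf ew e|i k k' A z rs /hs e _|i k _||c|];
  rewrite /= ?size_rcons ?size_map //=; try lia.
- by split; apply: leq_ltn_trans (hp i) _; lia.
- by rewrite e in ew; split; apply: leq_ltn_trans ew _; lia.
- by have ez := leq_trans e ew; split; apply: leq_ltn_trans ez _; lia.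
- by split; [lia|apply: leq_ltn_trans e _; lia].
Qed.

Lemma rule_nonterminal x y : rule x y ->
  has (fun a : sym T nonterminal => if a is inr _ then true else false) x.
Proof. by case=> [[-> _]|[a [q [b [_ ->]]]]]; rewrite // has_cat /= orbT. Qed.

Variable R : seq (letters * letters).
Hypothesis RP : forall x y, List.In (x, y) R <-> rule x y.

Notation reaches := (rtc (ps_step (N := nonterminal) R)).
Notation derives := (scm_derives M [:: inr S]).

(** * The invariant of the head grammar *)

Definition form (u : word T N) (q : head_state) (v : word T N) : letters :=
  lend :: cells u ++ head q :: rcons (cells v) rend.

Definition perm_ok (i : 'I_(size M)) x := infix (permitting i) x.
Definition forb_ok (i : 'I_(size M)) x :=
  forall w, mx_forb (matrix_at i) = Some w -> ~~ infix w x.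

(** Conditions are tested before any rule of the matrix is applied, so an applying head refers back
    to the tested word [x]. Only a completed matrix leads back to [idle], so an unfinished one
    yields no output. *)
Definition valid (q : head_state) (u v : word T N) : Prop :=
  match q with
  | None => False
  | Some None => derives (u ++ v)
  | Some (Some (i, None)) => derives (u ++ v) /\ perm_ok i (u ++ v)
  | Some (Some (i, Some None)) => [/\ derives (u ++ v), perm_ok i (u ++ v) &
      forall w a b, mx_forb (matrix_at i) = Some w -> u ++ v = a ++ w ++ b -> size u <= size a]
  | Some (Some (i, Some (Some k))) => exists x, [/\ derives x, perm_ok i x, forb_ok i x &
      apply_rules (take k (mx_rules (matrix_at i))) x (u ++ v)]
  end.

Lemma valid_free q u v u' v' : free q -> u ++ v = u' ++ v' -> valid q u v -> valid q u' v'.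
Proof. by case: q => [[[i [[k|]|]]|]|] //= _ ->. Qed.

Variant simulated : letters -> Prop :=
  | SimStart : simulated [:: inr start_symbol]
  | SimForm u q v of valid q u v : simulated (form u q v)
  | SimOutput w v of derives (map inl w ++ v) :
      simulated (map inl w ++ head output :: rcons (cells v) rend)
  | SimTerminal w of derives (map inl w) : simulated (map inl w).

Lemma cells_prefix v w b : rcons (cells v) rend = cells w ++ b ->
  exists2 v', v = w ++ v' & b = rcons (cells v') rend.
Proof.
elim: w v => [|s w IH] v /=; first by exists v.
case: v => [|t v] //= e; have [e1 e2] : t = s /\ rcons (cells v) rend = cells w ++ b.
  by case: e.
by have [v' -> ->] := IH _ e2; exists v'; rewrite ?e1.
Qed.

Lemma cells_right v w b : rcons (cells v) rend = rcons (cells w) rend ++ b -> v = w /\ b = [::].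
Proof.
rewrite cat_rcons => /cells_prefix [v' ->].
by case: v' => [|s v'] // [<-]; rewrite cats0.
Qed.

Lemma apply_rules_cat rs rs' x y z : apply_rules (T := T) (N := N) rs x y ->
  apply_rules rs' y z -> apply_rules (rs ++ rs') x z.
Proof.
elim: rs x => [|[A w] rs IH] x /= => [->//|[u [xu uy]] yz].
by exists u; split; last exact: IH.
Qed.

Definition is_head (s : sym T nonterminal) := if s is inr (inr (inl _)) then true else false.

Lemma head_split (a b c d : letters) (q q' : head_state) :
  ~~ has is_head a -> ~~ has is_head b ->
  a ++ head q :: b = c ++ head q' :: d -> [/\ a = c, q = q' & b = d].
Proof.
by move=> ha hb /(cat_mem_eq (h := head q) (h' := head q') ha hb isT isT) [-> [->] ->].
Qed.

Lemma is_head_cells v : has is_head (cells v) = false.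
Proof. by elim: v. Qed.

Lemma is_head_terminals w : has is_head (map inl w) = false.
Proof. by elim: w. Qed.

Lemma form_eq u q v w1 a q' b w2 : form u q v = w1 ++ (a ++ head q' :: b) ++ w2 ->
  [/\ lend :: cells u = w1 ++ a, q = q' & rcons (cells v) rend = b ++ w2].
Proof.
rewrite /form -cat_cons -!catA catA cat_cons -cat_cons => /head_split; apply.
  by rewrite /= is_head_cells.
by rewrite -cats1 has_cat is_head_cells.
Qed.

Lemma sim_head_rule a q b c x w1 w2 : head_rule a q b c -> simulated x ->
  x = w1 ++ (a ++ head q :: b) ++ w2 -> simulated (w1 ++ c ++ w2).
Proof.
move=> hr [|u q' v val|w v d|w d].
- by case: w1 a {hr} => [|? []] // [|? []].
- case/form_eq => e1 eq e2; subst q'.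
  case: hr e1 e2 val => {a q b c} [q s fq|q s fq|i|i hi|i|i w s z hi hw ne|i w z hi hw|
    i k k' A z rs hk hk'|i k hk||s|]; rewrite ?cats0.
  + move=> <- /(@cells_prefix _ [:: s]) [v' -> ->] val.
    have -> : (lend :: cells u) ++ [:: cell s; head q] ++ rcons (cells v') rend =
              form (rcons u s) q v' by rewrite /form /cells map_rcons cat_rcons.
    by apply: SimForm; apply: valid_free val => //; rewrite cat_rcons.
  + case: (lastP u) => [|u' s'] e1 /= <- val; first by case: w1 e1 => [|? []].
    move: e1; rewrite /cells map_rcons -rcons_cons cats1 => /rcons_inj [<- es].
    have {es} <- : s' = s by case: es.
    apply: (@SimForm u' q (s' :: v)).
    by apply: valid_free val => //; rewrite cat_rcons.
  + move=> <- /cells_prefix [v' -> ->] val.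
    have -> : (lend :: cells u) ++ (head (permitted i) :: cells (permitting i)) ++
              rcons (cells v') rend = form u (permitted i) (permitting i ++ v').
      by rewrite /form /cells map_cat rcons_cat.
    by apply: SimForm; split=> //; apply/infixP; exists u, v'.
  + move=> <- /= <- [d p]; apply: (@SimForm u (applying i ord0) v); exists (u ++ v).
    by split=> //; [rewrite /forb_ok hi|rewrite take0].
  + case: (lastP u) => [|u' s'] e1 /= <- [d p]; last first.
      by move: e1; rewrite /cells map_rcons -rcons_cons cats1 => /rcons_inj [_].
    have -> : w1 = [::] by case: w1 e1 => [|? []].
    by apply: (@SimForm [::] (scanning i) v); split.
  + move=> <- /cells_prefix [v' -> ->] [d p scan].
    have -> : (lend :: cells u) ++ (cell s :: head (scanning i) :: cells z) ++ rcons (cells v') rend =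
       form (rcons u s) (scanning i) (z ++ v').
      by rewrite /form /cells map_rcons cat_rcons map_cat rcons_cat.
    apply: SimForm; split; rewrite ?cat_rcons // => w' a' b' hw'.
    have [<-] : Some w = Some w' by rewrite -hi.
    rewrite size_rcons => e; rewrite ltn_neqAle (scan _ _ _ hi e) andbT.
    (* An occurrence starting exactly at the head would equal the window [s :: z], which was found
       to differ. *)
    apply/eqP => eu; apply: ne; move/eqP: e; rewrite eqseq_cat // => /andP [_].
    by rewrite -cat_cons eqseq_cat /= ?hz // => /andP [/eqP].
  + move=> <- /cells_right [-> ->] [d p scan].
    rewrite cats0; apply: (@SimForm u (applying i ord0) z); exists (u ++ z).
    split=> //; last by rewrite take0.
    move=> w' hw'; have [<-] : Some w = Some w' by rewrite -hi.
    apply/infixP => -[a' [b' e]].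
    (* An occurrence would start at the head or later, where fewer than [size w] cells remain. *)
    have := leq_add (scan _ _ _ hi e) (leq_trans hw (leq_addr (size b') _)).
    by move/(congr1 size): e; rewrite !size_cat addnS => <-; rewrite ltnn.
  + move=> <- /(@cells_prefix _ [:: inr A]) [v' -> ->] [y [d p f ap]].
    have -> : (lend :: cells u) ++ (head (applying i k') :: cells z) ++ rcons (cells v') rend =
       form u (applying i k') (z ++ v') by rewrite /form /cells map_cat rcons_cat.
    apply: SimForm; exists y; split=> //.
    have -> : take k' (mx_rules (matrix_at i)) = take k (mx_rules (matrix_at i)) ++ [:: (A, z)].
      rewrite hk' -addn1 takeD hk /=; by rewrite take0.
    apply: apply_rules_cat ap _; exists (u ++ z ++ v'); split=> //.
    by exists u, v'.
  + move=> <- /= <- [y [d p f ap]]; apply: (@SimForm u idle v) => /=.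
    apply: rtc_trans d _; apply: rtc_one; exists (matrix_at i); first by apply/In_matrix_at; exists i.
    split; first by move=> P hP; move: p; rewrite /perm_ok /permitting hP.
    by split=> //; rewrite -hk take_size in ap.
  + case: (lastP u) => [|u' s'] e1 /= <- d; last first.
      by move: e1; rewrite /cells map_rcons -rcons_cons cats1 => /rcons_inj [_].
    have -> : w1 = [::] by case: w1 e1 => [|? []].
    exact: (@SimOutput [::] v).
  + by [].
  + by [].
- rewrite -!catA catA => /head_split [].
  + by rewrite is_head_terminals.
  + by rewrite -cats1 has_cat is_head_cells.
  move=> e1 eq e2; case: hr e1 eq e2 => {a q b c} [q s fq|q s fq|i|i hi|i|i w' s z hi hw ne|
    i w' z hi hw|i k k' A z rs hk hk'|i k hk||s|] // e1 eq;
    try by rewrite -eq in fq.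
  + rewrite cats0 in e1; rewrite -e1 => /(@cells_prefix _ [:: inl s]) [v' ev ->].
    have -> : map inl w ++ [:: inl s; head output] ++ rcons (cells v') rend =
      map inl (rcons w s) ++ head output :: rcons (cells v') rend.
      by rewrite map_rcons cat_rcons.
    by apply: SimOutput; rewrite map_rcons cat_rcons; rewrite ev in d.
  + rewrite cats0 in e1; rewrite -e1 => /(@cells_right _ [::]) [ev ->].
    by rewrite !cats0; apply: SimTerminal; rewrite ev cats0 in d.
- move=> e; have := is_head_terminals w; rewrite e !has_cat /=.
  by rewrite !orbT.
Qed.

Definition is_start (s : sym T nonterminal) :=
  if s is inr (inr (inr None)) then true else false.

Lemma simulated_step x y : simulated x -> ps_step (N := nonterminal) R x y -> simulated y.
Proof.
move=> sx [l [r [w1 [w2 [/RP lr [ex ->]]]]]]; case: lr => [[el ->]|[a [q [b [hr el]]]]].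
  suff [-> ->] : w1 = [::] /\ w2 = [::].
    by apply: (@SimForm [::] idle [:: inr S]); apply: rtc_refl.
  have no z : has is_start z = false -> x = z -> False.
    by move=> hz xz; rewrite -xz ex el !has_cat /= !orbT in hz.
  have nc v : has is_start (cells v) = false.
    by elim: v.
  have nt v : has is_start (map inl v) = false.
    by elim: v.
  case: sx no ex => [|u q v _|w v _|w _] no ex.
  - by case: w1 ex => [|? [|? ?]]; rewrite el //= => -[<-].
  - by case: (no _ _ erefl); rewrite /form /= has_cat /= -cats1 has_cat !nc.
  - by case: (no _ _ erefl); rewrite has_cat /= -cats1 has_cat nc nt.
  - by case: (no _ _ erefl).
by rewrite el in ex; apply: sim_head_rule hr sx ex.
Qed.

Lemma simulated_terminal w : simulated (map inl w) -> derives (map inl w).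
Proof.
case e : {1}_ / => [|u q v _|w' v _|w' d].
- by case: w e.
- by case: w e.
- by have := is_head_terminals w; rewrite e has_cat /= orbT.
- have -> : w = w' by apply: inj_map e => ? ? [].
  exact: d.
Qed.

(** * Simulation of matrix derivations by the head *)

Lemma head_step a q b c w1 w2 x y : head_rule a q b c ->
  x = w1 ++ (a ++ head q :: b) ++ w2 -> y = w1 ++ c ++ w2 -> reaches x y.
Proof.
move=> hr -> ->; apply: rtc_one; exists (a ++ head q :: b), c, w1, w2; split=> //.
by apply/RP; right; exists a, q, b.
Qed.

Lemma move_right q u v w : free q -> reaches (form u q (v ++ w)) (form (u ++ v) q w).
Proof.
move=> fq; elim: v u => [|s v IH] u; first by rewrite cats0; apply: rtc_refl.
rewrite -cat_rcons; apply: rtc_trans _ (IH _).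
apply: (head_step (w1 := lend :: cells u) (w2 := rcons (cells (v ++ w)) rend) (MoveRight s fq)) => //.
by rewrite /form /cells map_rcons cat_rcons.
Qed.

Lemma move_left q u v w : free q -> reaches (form (u ++ v) q w) (form u q (v ++ w)).
Proof.
move=> fq; elim/last_ind: v w => [|v s IH] w; first by rewrite cats0; apply: rtc_refl.
rewrite cat_rcons; apply: rtc_trans _ (IH _).
apply: (head_step (w1 := lend :: cells (u ++ v)) (w2 := rcons (cells w) rend) (MoveLeft s fq)) => //.
by rewrite /form -rcons_cat /cells map_rcons cat_rcons.
Qed.

Lemma move_head q u v u' v' : free q -> u ++ v = u' ++ v' -> reaches (form u q v) (form u' q v').
Proof.
move=> fq e; apply: (rtc_trans (y := form [::] q (u ++ v))); first exact: (move_left [::]).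
by rewrite e; apply: (move_right [::]).
Qed.

Lemma reaches_permitted i x : infix (permitting i) x ->
  reaches (form [::] idle x) (form [::] (permitted i) x).
Proof.
move=> /infixP [a [b ->]].
apply: rtc_trans (move_head (u' := a) (v' := permitting i ++ b) _ _) _ => //.
apply: rtc_trans _ (move_head (u := a) (v := permitting i ++ b) _ _) => //.
apply: (head_step (w1 := lend :: cells a) (w2 := rcons (cells b) rend) (Permit i)).
- by rewrite /form {2}/cells map_cat rcons_cat.
- by rewrite /form {2}/cells map_cat rcons_cat.
Qed.

Lemma reaches_scanned (i : 'I_(size M)) w u v : mx_forb (matrix_at i) = Some w -> ~~ infix w v ->
  reaches (form u (scanning i) v) (form [::] (applying i ord0) (u ++ v)).
Proof.
move=> hw; elim: v u => [|s v IH] u nw.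
  case: w hw nw => [|t w] hw nw //; rewrite cats0.
  apply: rtc_trans _ (move_head (u := u) (v := [::]) _ _) => //; last by rewrite cats0.
  by apply: (head_step (w1 := lend :: cells u) (w2 := [::]) (ScanEnd (x := [::]) hw _)).
case: (ltnP (size (s :: v)) (size w)) => lt.
  apply: rtc_trans _ (move_head (u := u) (v := s :: v) _ _) => //.
  apply: (head_step (w1 := lend :: cells u) (w2 := [::]) (ScanEnd (x := s :: v) hw _)) => //.
    by rewrite cats0.
  by rewrite cats0.
have w0 : 0 < size w by case: (w) nw.
(* [s :: z] is the window of length [size w] read at the head. *)
pose z := take (size w).-1 v.
have sz : size w = (size z).+1.
  by rewrite size_take_min (minn_idPl _) ?prednK // -ltnS prednK.
have ne : s :: z <> w.
  move=> e; case/negP: nw; apply/infixP; exists [::], (drop (size w).-1 v).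
  by rewrite -{1}e /= cat_take_drop.
rewrite -cat_rcons; apply: rtc_trans _ (IH _ _); last first.
  by apply: contra nw => /infixP [a [b ->]]; apply/infixP; exists (s :: a), b.
apply: (head_step (w1 := lend :: cells u) (w2 := rcons (cells (drop (size w).-1 v)) rend)
  (ScanMove hw sz ne)).
  by rewrite -{1}(cat_take_drop (size w).-1 v) /form /= /cells map_cat rcons_cat.
rewrite -{1}(cat_take_drop (size w).-1 v) /form /cells map_rcons cat_rcons map_cat rcons_cat.
by [].
Qed.

Lemma reaches_forbidden i x : forb_ok i x ->
  reaches (form [::] (permitted i) x) (form [::] (applying i ord0) x).
Proof.
rewrite /forb_ok; case hw: (mx_forb (matrix_at i)) => [w|] ok; last first.
  exact: (head_step (w1 := [:: lend]) (w2 := rcons (cells x) rend) (NoForbidden hw)).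
apply: rtc_trans _ (reaches_scanned [::] hw (ok _ erefl)).
exact: (head_step (w1 := [::]) (w2 := rcons (cells x) rend) (ScanStart i)).
Qed.

Lemma reaches_applied (i : 'I_(size M)) (k : 'I_max_rules.+1) x y :
  k <= size (mx_rules (matrix_at i)) ->
  apply_rules (drop k (mx_rules (matrix_at i))) x y ->
  reaches (form [::] (applying i k) x) (form [::] idle y).
Proof.
have bound : size (mx_rules (matrix_at i)) <= max_rules.
  exact: (leq_bigmax (F := fun i : 'I_(size M) => size (mx_rules (matrix_at i))) i).
move ers : (drop k _) => rs; elim: rs k ers x => [|[A w] rs IH] k ers x lek.
  move=> /= <-.
  have sk : size (mx_rules (matrix_at i)) = k.
    by apply/eqP; rewrite eqn_leq lek andbT -subn_eq0 -size_drop ers.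
  exact: (head_step (w1 := [:: lend]) (w2 := rcons (cells x) rend) (Applied sk)).
case=> z [[a [b [-> ->]]] ap].
have ltk : k < size (mx_rules (matrix_at i)) by rewrite -subn_gt0 -size_drop ers.
(* The index stays in range because a rule is still pending at position [k]. *)
pose k' : 'I_max_rules.+1 := inord k.+1.
have ek : k' = k.+1 :> nat by rewrite inordK // ltnS (leq_trans ltk bound).
apply: rtc_trans (move_head (u' := a) (v' := inr A :: b) _ _) _ => //.
apply: rtc_trans _ (IH k' _ _ _ ap); last 2 first.
- by rewrite ek -addn1 addnC -drop_drop ers /= drop0.
- by rewrite ek.
apply: rtc_trans _ (move_head (u := a) (v := w ++ b) _ _) => //.
apply: (head_step (w1 := lend :: cells a) (w2 := rcons (cells b) rend) (Apply ers ek)) => //.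
by rewrite /form /cells map_cat rcons_cat.
Qed.

Lemma reaches_derived x : derives x -> reaches [:: inr start_symbol] (form [::] idle x).
Proof.
move=> d; apply: (rtc_invariant (I := fun x => reaches [:: inr start_symbol] (form [::] idle x))
  _ d).
  move=> y z ry [r /In_matrix_at [i ->] [hp [hf ap]]]; apply: rtc_trans ry _.
  apply: rtc_trans (reaches_permitted (i := i) _) _.
    rewrite /permitting; case e: (mx_perm _) hp => [P|] hp; first exact: hp.
    by apply/infixP; exists [::], y.
  apply: rtc_trans (reaches_forbidden (i := i) hf) _.
  by apply: reaches_applied => //=; rewrite drop0.
apply: rtc_one; exists [:: inr start_symbol], (form [::] idle [:: inr S]), [::], [::].
by split=> //; apply/RP; left.
Qed.

Lemma reaches_output w v : reaches (map inl w ++ head output :: rcons (cells (map inl v)) rend)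
  (map inl (w ++ v)).
Proof.
elim: v w => [|a v IH] w.
  by apply: (head_step (w1 := map inl w) (w2 := [::]) OutputEnd); rewrite ?cats0.
rewrite -cat_rcons; apply: rtc_trans _ (IH _).
apply: (head_step (w1 := map inl w) (w2 := rcons (cells (map inl v)) rend) (OutputLetter a)) => //.
by rewrite map_rcons cat_rcons.
Qed.

Lemma head_grammar_correct w :
  rtc (ps_step (N := nonterminal) R) [:: inr start_symbol] (map inl w) <-> scm_generates M S w.
Proof.
split=> d.
  apply: simulated_terminal; apply: rtc_invariant d _; [exact: simulated_step|exact: SimStart].
apply: rtc_trans (reaches_derived d) _; apply: rtc_trans _ (reaches_output [::] w).
exact: (head_step (w1 := [::]) (w2 := rcons (cells (map inl w)) rend) OutputStart).
Qed.

End HeadGrammar.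

Lemma SCM_RE i j n m l s (T : finType) (L : seq T -> Prop) : SCM i j n m l s L -> RE L.
Proof.
case=> N [S [M [_ _ _ _ LM]]].
have [B bB] := rule_bounded S M.
have [R RP] := bounded_relation_list (X := (T + nonterminal M)%type) bB.
exists (nonterminal M), (start_symbol M), R; split=> [u v /RP /rule_nonterminal //|w].
by rewrite LM (head_grammar_correct RP).
Qed.

Theorem mainTheorem7 (T : finType) (L : seq T -> Prop) :
  RE L <-> SCM 6 3 3 None 2 4 L.
Proof. by split=> [/RE_SCM|/SCM_RE]. Qed.
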